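(* Let $F:\mathscr K\to L^2(\Omega)$ be uniformly continuous, let $X^0\in\mathscr K$, $V^0\in L^2(\Omega)$, $T>0$, and let $X\in\mathrm{Lip}_{\mathrm{loc}}([0,\infty);\mathscr K)$ be a Lagrangian solution, i.e. $X(0)=X^0$ and $$\dot X(t)+\partial I_{\mathscr K}(X(t))\ni U(t)\ \text{for a.e. }t\ge0,\qquad U(t)=V^0+\int_0^tF[X(s)]\,ds,$$ with velocity $V(t)$ equal to the right derivative of $X$. For $t\in[0,T]$ let $M(t,\cdot)$ be the right-continuous generalized inverse of $X(t)$, and $M^0$ that of $X^0$. Then $M$ is an entropy solution on $[0,T]$ of $$\partial_tM+\partial_x\mathcal U(t,M)=0,\qquad \mathcal U(t,m)=\int_0^mU(t,\omega)\,d\omega,$$ with initial datum $M^0$.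
   Context: $\Omega=(0,1)$ with Lebesgue measure; $\mathscr K=\{X\in L^2(\Omega):X\text{ nondecreasing}\}$ (right-continuous representatives), a closed convex cone. $I_{\mathscr K}$ is the indicator function ($0$ on $\mathscr K$, $+\infty$ off it), and $\partial I_{\mathscr K}(X)=N_X\mathscr K=\{W\in L^2(\Omega):\int_\Omega W(Y-X)\,dm\le0\ \forall Y\in\mathscr K\}$. $F$ uniformly continuous means $\|F[X_1]-F[X_2]\|_{L^2}\le\omega(\|X_1-X_2\|_{L^2})$ for a modulus of continuity $\omega$ (continuous, concave, $\omega(0)=0<\omega(r)$ for $r>0$). The right-continuous generalized inverse of $X\in\mathscr K$ is $M(x)=|\{m\in\Omega:X(m)\le x\}|$. An entropy solution with initial datum $M^0$ is $M\in L^\infty((0,T)\times\mathbb{R})\cap C([0,T];L^1_{\mathrm{loc}}(\mathbb{R}))$ with $\int_0^T\!\int_{\mathbb{R}}(|M-k|\varphi_t+\operatorname{sgn}(M-k)(\mathcal U(t,M)-\mathcal U(t,k))\varphi_x)\,dx\,dt+\int_{\mathbb{R}}|M^0-k|\varphi(0,x)\,dx\ge0$ for all $k$ in a dense subset of $\mathbb{R}$ and all nonnegative $\varphi\in C_c^\infty([0,T)\times\mathbb{R})$. *)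

(* Defs.v *)
From HB Require Import structures.
From mathcomp Require Import all_boot all_order all_algebra.
From mathcomp Require Import all_classical all_reals all_analysis.
Set Implicit Arguments. Unset Strict Implicit. Unset Printing Implicit Defensive.
Import Order.TTheory GRing.Theory Num.Theory.
Import numFieldNormedType.Exports.
Local Open Scope classical_set_scope.
Local Open Scope ring_scope.

Section Defs.
Variable R : realType.

Definition leb := (@lebesgue_measure R).

Definition Omega : set R := `]0, 1[.

(* X : Omega -> R is (a representative of) an element of L^2(Omega) *)
Definition L2 (f : R -> R) : Prop :=
  measurable_fun Omega f /\
  (\int[leb]_(m in Omega) ((f m) ^+ 2)%:E < +oo)%E.

Definition norm2 (f : R -> R) : R :=
  Num.sqrt (fine (\int[leb]_(m in Omega) ((f m) ^+ 2)%:E)).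

Definition inner (f g : R -> R) : R :=
  fine (\int[leb]_(m in Omega) (f m * g m)%:E).

(* the cone K of nondecreasing elements of L^2(Omega) (via a nondecreasing
   representative) *)
Definition inK (X : R -> R) : Prop :=
  L2 X /\ {in Omega &, forall m1 m2, m1 <= m2 -> X m1 <= X m2}.

(* W \in N_X K = \partial I_K(X) *)
Definition normal_cone (X W : R -> R) : Prop :=
  inK X /\ L2 W /\ forall Y, inK Y -> inner W (Y \- X) <= 0.

Definition modulus (w : R -> R) : Prop :=
  {within `[0, +oo[, continuous w} /\
  (forall a b l, 0 <= a -> 0 <= b -> 0 <= l <= 1 ->
     l * w a + (1 - l) * w b <= w (l * a + (1 - l) * b)) /\
  w 0 = 0 /\ (forall r, 0 < r -> 0 < w r).

Definition unif_cont_on_K (F : (R -> R) -> (R -> R)) : Prop :=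
  (forall X, inK X -> L2 (F X)) /\
  exists w, modulus w /\
    forall X1 X2, inK X1 -> inK X2 -> norm2 (F X1 \- F X2) <= w (norm2 (X1 \- X2)).

Definition lip_loc_K (X : R -> R -> R) : Prop :=
  (forall t, 0 <= t -> inK (X t)) /\
  forall S, 0 < S -> exists L : R, forall s t, 0 <= s <= S -> 0 <= t <= S ->
     norm2 (X t \- X s) <= L * `|t - s|.

Definition L2_deriv (X : R -> R -> R) (t : R) (W : R -> R) : Prop :=
  L2 W /\
  (fun h => norm2 ((fun m => (X (t + h) m - X t m) / h) \- W)) @ 0^' --> 0.

(* U(t) = V0 + int_0^t F[X(s)] ds, the (Bochner) integral in L^2(Omega),
   characterized by testing against every element of L^2(Omega) *)
Definition is_U (F : (R -> R) -> (R -> R)) (X : R -> R -> R) (V0 : R -> R)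
    (U : R -> R -> R) : Prop :=
  forall t, 0 <= t -> L2 (U t) /\
    forall phi, L2 phi ->
      inner (U t) phi =
        inner V0 phi + Rintegral leb `[0, t] (fun s => inner (F (X s)) phi).

Definition lagrangian_solution (F : (R -> R) -> (R -> R)) (X0 V0 : R -> R)
    (X U : R -> R -> R) : Prop :=
  lip_loc_K X /\ norm2 (X 0 \- X0) = 0 /\ is_U F X V0 U /\
  {ae leb, forall t, 0 <= t ->
     exists W, L2_deriv X t W /\ normal_cone (X t) (U t \- W)}.

Definition gen_inv (Y : R -> R) (x : R) : R :=
  fine (leb (Omega `&` [set m | Y m <= x])).

(* calU(t,m) = int_0^m U(t,w) dw  (U extended by 0 outside Omega) *)
Definition calU (U : R -> R -> R) (t k : R) : R :=
  Rintegral leb (Omega `&` `]0, k]) (U t).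

Fixpoint pderiv (w : seq bool) (f : R -> R -> R) : R -> R -> R :=
  match w with
  | [::] => f
  | b :: w' => let g := pderiv w' f in
      if b then (fun t x => derive1 (fun s => g s x) t)
      else (fun t x => derive1 (g t) x)
  end.

Definition smooth2 (f : R -> R -> R) : Prop :=
  forall w, (forall t x, derivable (fun s => pderiv w f s x) t 1 /\
                         derivable (pderiv w f t) x 1) /\
            continuous (fun p : R * R => pderiv w f p.1 p.2).

Definition nonneg_test_fun (T : R) (phi : R -> R -> R) : Prop :=
  smooth2 phi /\
  (forall t x, 0 <= t -> 0 <= phi t x) /\
  exists T' R0, T' < T /\
    forall t x, 0 <= t -> (T' <= t \/ R0 <= `|x|) -> phi t x = 0.

Definition entropy_solution (T : R) (flux : R -> R -> R) (M : R -> R -> R)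
    (M0 : R -> R) : Prop :=
  measurable_fun (`]0, T[ `*` setT) (fun p : R * R => M p.1 p.2) /\
  (exists C : R, forall t x, 0 <= t <= T -> `|M t x| <= C) /\
  (forall t, 0 <= t <= T -> measurable_fun setT (M t)) /\
  (forall a b t0, 0 <= t0 <= T ->
     (fun t => Rintegral leb `[a, b] (fun x => `|M t x - M t0 x|))
       @ within `[0, T] (nbhs t0) --> 0) /\
  exists D : set R, dense D /\
    forall k, D k -> forall phi, nonneg_test_fun T phi ->
      (0 <= \int[leb]_(t in (`]0%R, T%R[ : set R))
              \int[leb]_(x in [set: R])
                 (`|M t x - k| * (pderiv [:: true] phi) t x
                  + Num.sg (M t x - k) * (flux t (M t x) - flux t k)
                    * (pderiv [:: false] phi) t x)%:E
          + \int[leb]_(x in [set: R]) (`|M0 x - k| * phi 0 x)%:E)%E.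

End Defs.

(* Main.v *)
(** Fix [k] and put [s(m) = sgn(k - m)].  The sublevel set [{X(t) <= x}] is the
    interval [(0, M(t,x))] up to an endpoint, so that Fubini's theorem gives, for
    every integrable [psi] with primitive [P],
    [int sgn(M - k) (Q(M) - Q(k)) psi dx = int_Omega u s P(X) dm + const * int psi],
    where [Q] is the primitive of [u].  With [u = 1] this expresses
    [G(t) = int |M - k| phi dx], and with [u = U(t)], [psi = phi_x] the entropy flux
    term becomes [int_Omega U s phi(t, X) dm].  Differentiating in time,
    [G' = int |M - k| phi_t dx + int_Omega V s phi(t, X) dm] for a.e. [t], and
    [int_Omega (U - V) s phi(t, X) dm >= 0] because [U - V] is normal to the cone
    at [X] and [X - eps s phi(t, X)] is nondecreasing for small [eps].  Hence [G'] is
    at most the integrand of the entropy inequality; integrate from [0], where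
    [G] is the initial term, to [T], where [G] vanishes. *)

Require Import Defs.
From HB Require Import structures.
From mathcomp Require Import all_boot all_order all_algebra.
From mathcomp Require Import all_classical all_reals all_analysis.
From mathcomp Require Import measurable_realfun ring lra.
Set Implicit Arguments. Unset Strict Implicit. Unset Printing Implicit Defensive.
Import Order.TTheory GRing.Theory Num.Theory.
Import numFieldNormedType.Exports.
Local Open Scope classical_set_scope.
Local Open Scope ring_scope.

(** The curve [t -> X t] is Lipschitz only in the norm of L2, and [M] may jump in [x], so nothing
    can be differentiated pointwise on the side of [M]. After the exchange of integrals, time enters
    only through Lipschitz functions evaluated at [X t]. The second-order remainder is then
    quadratic in [X (t + h) - X t], so the squared L2 norm controls it and no pointwise bound on [X]
    is called for. Almost-everywhere differentiability of [G] is bypassed. Normality to the cone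
    only yields an inequality, so it is enough to bound the right difference quotients of [G] from
    above at almost every time, up to an error tending to 0; integrating these quotients over a
    fixed interval telescopes. Time 0 is delicate: a test function is controlled only for [t >= 0],
    so its derivatives are controlled only for [t > 0]. Hence [G] is estimated on a closed time
    interval, but the integrand of the entropy inequality on an open one. *)

Section L2.
Context {R : realType}.
Local Notation mu := (@lebesgue_measure R).
Local Notation Omega := (@Omega R).
Implicit Types f g h : R -> R.

(** * The space L2 on the unit interval *)

Lemma measurable_Omega : measurable (Omega : set (measurableTypeR R)).
Proof. exact: measurable_itv. Qed.
Hint Resolve measurable_Omega : core.

Lemma mu_Omega : mu Omega = 1%E.
Proof. by rewrite /Defs.Omega lebesgue_measure_itv /= lte01 sube0. Qed.

Lemma bounded_integrable_Omega f c : measurable_fun Omega f ->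
  (forall m, Omega m -> `|f m| <= c) -> mu.-integrable Omega (EFin \o f).
Proof.
move=> mf fc; apply: measurable_bounded_integrable => //.
  by rewrite [ltLHS]mu_Omega ltry.
by exists c; split; [exact: num_real|move=> y cy x /= Ox; apply: le_trans (fc _ Ox) (ltW cy)].
Qed.

Lemma L2_sqr f : L2 f -> mu.-integrable Omega (EFin \o (fun m => f m ^+ 2)).
Proof.
move=> [mf fi]; apply/integrableP; split.
  by apply/measurable_EFinP/measurable_funX.
under eq_integral do rewrite /= ger0_norm ?sqr_ge0//.
exact: fi.
Qed.

Lemma L2P f : measurable_fun Omega f ->
  mu.-integrable Omega (EFin \o (fun m => f m ^+ 2)) -> L2 f.
Proof.
move=> mf /integrableP[_ fi]; split => //; apply: le_lt_trans fi.
by under [leRHS]eq_integral do rewrite /= ger0_norm ?sqr_ge0//.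
Qed.

Lemma L2_mul f g : L2 f -> L2 g -> mu.-integrable Omega (EFin \o (fun m => f m * g m)).
Proof.
move=> Lf Lg; have := integrableD measurable_Omega (L2_sqr Lf) (L2_sqr Lg).
apply: le_integrable => //.
  by apply/measurable_EFinP/measurable_funM; [exact: Lf.1|exact: Lg.1].
move=> x _ /=; rewrite lee_fin normrM [leRHS]ger0_norm ?addr_ge0 ?sqr_ge0//.
rewrite -(real_normK (num_real (f x))) -(real_normK (num_real (g x))).
have := normr_ge0 (f x); have := normr_ge0 (g x); nra.
Qed.

Lemma L2_le_norm f g : measurable_fun Omega f -> L2 g ->
  (forall m, Omega m -> `|f m| <= `|g m|) -> L2 f.
Proof.
move=> mf Lg fg; apply: L2P => //; apply: le_integrable (L2_sqr Lg) => //.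
  by apply/measurable_EFinP/measurable_funX.
by move=> x Ox /=; rewrite lee_fin !normrX; apply: lerXn2r; rewrite ?nnegrE//; exact: fg.
Qed.

Lemma L2_bounded f c : measurable_fun Omega f ->
  (forall m, Omega m -> `|f m| <= c) -> L2 f.
Proof.
move=> mf fc; apply: L2P => //; apply: (@bounded_integrable_Omega _ (c ^+ 2)).
  exact: measurable_funX.
move=> m Om; rewrite normrX; apply: lerXn2r; rewrite ?nnegrE//.
  by apply: le_trans (fc _ Om).
exact: fc.
Qed.

Lemma L2_cst (c : R) : L2 (fun=> c).
Proof. by apply: (@L2_bounded _ `|c|). Qed.

Lemma L2D f g : L2 f -> L2 g -> L2 (fun m => f m + g m).
Proof.
move=> Lf Lg; apply: L2P; first by apply: measurable_funD; [exact: Lf.1|exact: Lg.1].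
have := integrableD measurable_Omega (integrableD measurable_Omega (L2_sqr Lf) (L2_sqr Lg))
  (integrableZl measurable_Omega 2 (L2_mul Lf Lg)).
by apply: eq_integrable => // x _ /=; congr EFin; ring.
Qed.

Lemma L2Z c f : L2 f -> L2 (fun m => c * f m).
Proof.
move=> Lf; apply: L2P; first by apply: measurable_funM => //; exact: Lf.1.
have := integrableZl measurable_Omega (c ^+ 2) (L2_sqr Lf).
by apply: eq_integrable => // x _ /=; congr EFin; ring.
Qed.

Lemma L2B f g : L2 f -> L2 g -> L2 (fun m => f m - g m).
Proof.
move=> Lf Lg; rewrite (_ : (fun m => _) = (fun m => f m + (-1) * g m)).
  by apply: L2D => //; apply: L2Z.
by apply/funext => m; ring.
Qed.

Lemma L2_norm f : L2 f -> L2 (fun m => `|f m|).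
Proof.
move=> Lf; apply: (L2_le_norm _ Lf); last by move=> m _; rewrite normr_id.
by apply: measurableT_comp => //; exact: Lf.1.
Qed.

Lemma L2_integrable f : L2 f -> mu.-integrable Omega (EFin \o f).
Proof.
move=> Lf; have := L2_mul Lf (L2_cst 1).
by apply: eq_integrable => // x _ /=; rewrite mulr1.
Qed.

Lemma innerE f g : inner f g = \int[mu]_(m in Omega) (f m * g m).
Proof. by []. Qed.

Lemma innerC f g : inner f g = inner g f.
Proof. by rewrite !innerE; apply: eq_Rintegral => m _; rewrite mulrC. Qed.

Lemma eq_inner f f' g g' : (forall m, Omega m -> f m * g m = f' m * g' m) ->
  inner f g = inner f' g'.
Proof. by move=> e; rewrite !innerE; apply: eq_Rintegral => m /set_mem /e. Qed.

Lemma innerDl f g h : L2 f -> L2 g -> L2 h ->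
  inner (fun m => f m + g m) h = inner f h + inner g h.
Proof.
move=> Lf Lg Lh; rewrite !innerE -RintegralD//; [|exact: L2_mul..].
by apply: eq_Rintegral => m _; rewrite mulrDl.
Qed.

Lemma innerZl c f h : L2 f -> L2 h -> inner (fun m => c * f m) h = c * inner f h.
Proof.
move=> Lf Lh; rewrite !innerE -RintegralZl//; last exact: L2_mul.
by apply: eq_Rintegral => m _; rewrite mulrA.
Qed.

Lemma innerBl f g h : L2 f -> L2 g -> L2 h ->
  inner (fun m => f m - g m) h = inner f h - inner g h.
Proof.
move=> Lf Lg Lh; rewrite !innerE -RintegralB//; [|exact: L2_mul..].
by apply: eq_Rintegral => m _; rewrite mulrBl.
Qed.

Lemma innerBr f g h : L2 f -> L2 g -> L2 h ->
  inner h (fun m => f m - g m) = inner h f - inner h g.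
Proof. by move=> *; rewrite innerC innerBl// !(innerC h). Qed.

Lemma norm2_ge0 f : 0 <= norm2 f.
Proof. exact: sqrtr_ge0. Qed.

Lemma norm2_sqr f : norm2 f ^+ 2 = inner f f.
Proof.
rewrite sqr_sqrtr ?innerE; last first.
  by apply: Rintegral_ge0 => m _; exact: sqr_ge0.
by apply: eq_Rintegral => m _; rewrite expr2.
Qed.

Lemma eq_norm2 f g : (forall m, Omega m -> f m ^+ 2 = g m ^+ 2) -> norm2 f = norm2 g.
Proof.
move=> e; rewrite /norm2; congr (Num.sqrt (fine _)); apply: eq_integral => m.
by rewrite inE => /e ->.
Qed.

Lemma le_norm2 f g : L2 f -> L2 g ->
  (forall m, Omega m -> `|f m| <= `|g m|) -> norm2 f <= norm2 g.
Proof.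
move=> Lf Lg fg; apply: ler_wsqrtr; apply: le_Rintegral => //; [exact: L2_sqr..|].
move=> m Om; rewrite -(real_normK (num_real (f m))) -(real_normK (num_real (g m))).
by apply: lerXn2r; rewrite ?nnegrE//; exact: fg.
Qed.

Lemma norm2_cst (c : R) : norm2 (fun=> c) = `|c|.
Proof.
rewrite -sqrtr_sqr /norm2; congr Num.sqrt.
have := @Rintegral_cst _ _ _ mu Omega measurable_Omega (c ^+ 2).
by rewrite [X in fine X]mu_Omega /= mulr1.
Qed.

Lemma cauchy_schwarz f g : L2 f -> L2 g -> `|inner f g| <= norm2 f * norm2 g.
Proof.
move=> Lf Lg.
have key (l : R) : 0 <= l ^+ 2 * norm2 f ^+ 2 + 2 * l * inner f g + norm2 g ^+ 2.
  have : 0 <= norm2 (fun m => l * f m + g m) ^+ 2 by exact: sqr_ge0.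
  have Llf := L2Z l Lf; have Llfg := L2D Llf Lg.
  rewrite !norm2_sqr innerDl// innerZl// (innerC f) (innerC g) !innerDl// !innerZl//.
  by rewrite (innerC g f); congr (_ <= _); ring.
set A := norm2 f in key *; set C := norm2 g in key *; set B := inner f g in key *.
have A0 : 0 <= A by exact: norm2_ge0.
have C0 : 0 <= C by exact: norm2_ge0.
have [A00|An0] := eqVneq A 0.
  rewrite A00 mul0r; have [->|B0] := eqVneq B 0; first by rewrite normr0.
  (* When [A = 0] the quadratic is affine in [l]; this [l] gives it the value -1. *)
  have := key (- (C ^+ 2 + 1) / (2 * B)); rewrite A00.
  rewrite (_ : _ + _ + _ = -1); last by field.
  by rewrite ler0N1.
have Ap : 0 < A ^+ 2 by rewrite exprn_gt0// lt_neqAle eq_sym An0.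
have : B ^+ 2 <= (A * C) ^+ 2.
  (* The minimiser of the quadratic in [l]. *)
  have := key (- B / A ^+ 2).
  rewrite (_ : _ + _ + _ = ((A * C) ^+ 2 - B ^+ 2) / A ^+ 2); last by field.
  by rewrite pmulr_lge0 ?invr_gt0// subr_ge0.
by rewrite -(real_normK (num_real B)) ler_pXn2r ?nnegrE ?mulr_ge0.
Qed.

Lemma norm2D f g : L2 f -> L2 g -> norm2 (fun m => f m + g m) <= norm2 f + norm2 g.
Proof.
move=> Lf Lg.
rewrite -(@ler_pXn2r _ 2)// ?nnegrE ?addr_ge0 ?norm2_ge0//.
have Lfg := L2D Lf Lg.
rewrite norm2_sqr innerDl// (innerC f) (innerC g) !innerDl// (innerC g f).
rewrite -!norm2_sqr sqrrD.
have := cauchy_schwarz Lf Lg; rewrite ler_norml => /andP[_].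
by rewrite -(ler_pMn2r (n:=2))//; lra.
Qed.

Lemma Rintegral_norm_le f : L2 f -> \int[mu]_(m in Omega) `|f m| <= norm2 f.
Proof.
move=> Lf; have := cauchy_schwarz (L2_norm Lf) (L2_cst 1).
rewrite norm2_cst normr1 mulr1 (@eq_norm2 _ f) => [|m _]; last by rewrite real_normK ?num_real.
move=> /(le_trans (ler_norm _)); apply: le_trans; rewrite innerE le_eqVlt; apply/orP; left.
by apply/eqP/eq_Rintegral => m _; rewrite mulr1.
Qed.

Lemma norm2B f g h : L2 f -> L2 g -> L2 h ->
  norm2 (fun m => f m - h m) <= norm2 (fun m => f m - g m) + norm2 (fun m => g m - h m).
Proof.
move=> Lf Lg Lh; apply: le_trans (norm2D (L2B Lf Lg) (L2B Lg Lh)).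
by rewrite le_eqVlt; apply/orP; left; apply/eqP/eq_norm2 => m _; congr (_ ^+ 2); ring.
Qed.

Lemma L2M_bounded f g c : L2 f -> measurable_fun Omega g ->
  (forall m, Omega m -> `|g m| <= c) -> L2 (fun m => f m * g m).
Proof.
move=> Lf mg gc; apply: (L2_le_norm _ (L2Z c Lf)).
  by apply: measurable_funM => //; exact: Lf.1.
move=> m Om; rewrite !normrM mulrC ler_wpM2r//.
by apply: le_trans (gc _ Om) (ler_norm _).
Qed.

End L2.
#[export] Hint Resolve measurable_Omega : core.

(** * Fubini's theorem for a bounded kernel *)

Section Fubini_kernel.
Context d1 d2 (T1 : measurableType d1) (T2 : measurableType d2) (R : realType).
Context (m1 : {sigma_finite_measure set T1 -> \bar R})
        (m2 : {sigma_finite_measure set T2 -> \bar R}).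
Implicit Types (psi : T1 -> R) (v : T2 -> R) (kappa : T1 -> T2 -> R).

Lemma integrable_tensor psi v :
  m1.-integrable setT (EFin \o psi) -> m2.-integrable setT (EFin \o v) ->
  (m1 \x m2)%E.-integrable setT (EFin \o (fun p => psi p.1 * v p.2)).
Proof.
move=> ipsi iv.
have mpsi : measurable_fun setT psi by apply/measurable_EFinP/(measurable_int m1).
have mv : measurable_fun setT v by apply/measurable_EFinP/(measurable_int m2).
apply/integrable12ltyP.
  apply/measurable_EFinP/measurable_funM.
    by apply: measurableT_comp => //; exact: measurable_fst.
  by apply: measurableT_comp => //; exact: measurable_snd.
have [_ fv] := integrableP _ _ _ iv; have [_ fpsi] := integrableP _ _ _ ipsi.
under eq_integral => x _.
  under eq_integral do rewrite /= normrM EFinM.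
  rewrite ge0_integralZl//; last first.
    by apply/measurable_EFinP; apply: measurableT_comp.
  over.
rewrite /=.
have [c cE] : exists c, (\int[m2]_y `|v y|%:E = c%:E)%E.
  exists (fine (\int[m2]_y `|v y|%:E)%E); rewrite fineK// ge0_fin_numE//.
  by apply: integral_ge0 => y _; rewrite lee_fin.
rewrite cE.
rewrite ge0_integralZr//; last 2 first.
- by apply/measurable_EFinP; apply: measurableT_comp.
- by rewrite -cE; apply: integral_ge0 => y _; rewrite lee_fin.
rewrite lte_mul_pinfty//; first by apply: integral_ge0 => y _; rewrite lee_fin.
  by rewrite ge0_fin_numE//; apply: integral_ge0 => y _; rewrite lee_fin.
exact: ltry.
Qed.

(** The integrand is dominated by [c] times the tensor product of [psi] and [v], which is integrable
    on the product space. The rest is the passage between extended and real integrals. *)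
Lemma Fubini_kernel psi v kappa c :
  m1.-integrable setT (EFin \o psi) -> m2.-integrable setT (EFin \o v) ->
  measurable_fun setT (fun p => kappa p.1 p.2) ->
  (forall x y, `|kappa x y| <= c) ->
  m1.-integrable setT (EFin \o (fun x => psi x * \int[m2]_y (v y * kappa x y))) /\
  \int[m1]_x (psi x * \int[m2]_y (v y * kappa x y)) =
  \int[m2]_y (v y * \int[m1]_x (psi x * kappa x y)).
Proof.
move=> ipsi iv mk kc.
have mpsi : measurable_fun setT psi by apply/measurable_EFinP/(measurable_int m1).
have mv : measurable_fun setT v by apply/measurable_EFinP/(measurable_int m2).
pose f p := psi p.1 * (v p.2 * kappa p.1 p.2).
have if_ : (m1 \x m2)%E.-integrable setT (EFin \o f).
  have := integrableZl measurableT c (integrable_tensor ipsi iv).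
  apply: le_integrable => //.
    apply/measurable_EFinP; apply: measurable_funM.
      by apply: measurableT_comp => //; exact: measurable_fst.
    apply: measurable_funM => //.
    by apply: measurableT_comp => //; exact: measurable_snd.
  move=> [x y] _ /=; rewrite lee_fin /f /=.
  have -> : `|psi x * (v y * kappa x y)| = `|kappa x y| * (`|v y| * `|psi x|).
    by rewrite !normrM; ring.
  have -> : `|c * (psi x * v y)| = `|c| * (`|v y| * `|psi x|) by rewrite !normrM; ring.
  by apply: ler_wpM2r; [rewrite mulr_ge0|apply: le_trans (kc x y) (ler_norm _)].
have ikx x : m2.-integrable setT (EFin \o (fun y => v y * kappa x y)).
  have := integrableZl measurableT c iv; apply: le_integrable => //.
    apply/measurable_EFinP; apply: measurable_funM => //.
    exact: (measurableT_comp mk (measurable_pair1 x)).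
  move=> y _ /=; rewrite lee_fin !normrM mulrC ler_wpM2r//.
  by apply: le_trans (kc x y) (ler_norm _).
have iky y : m1.-integrable setT (EFin \o (fun x => psi x * kappa x y)).
  have := integrableZl measurableT c ipsi; apply: le_integrable => //.
    apply/measurable_EFinP; apply: measurable_funM => //.
    exact: (measurableT_comp mk (measurable_pair2 y)).
  move=> x _ /=; rewrite lee_fin !normrM mulrC ler_wpM2r//.
  by apply: le_trans (kc x y) (ler_norm _).
have F1 x : (\int[m2]_y (f (x, y))%:E = (psi x * \int[m2]_y (v y * kappa x y))%:E)%E.
  rewrite /f/=; under eq_integral do rewrite EFinM.
  rewrite integralZl ?ikx// EFinM /Rintegral fineK//.
  by apply: integrable_fin_num => //; exact: ikx.
have F2 y : (\int[m1]_x (f (x, y))%:E = (v y * \int[m1]_x (psi x * kappa x y))%:E)%E.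
  rewrite /f/=; under eq_integral => x _.
    rewrite (_ : psi x * _ = v y * (psi x * kappa x y)); last by ring.
    rewrite EFinM; over.
  rewrite /= integralZl ?iky// EFinM /Rintegral fineK//.
  by apply: integrable_fin_num => //; exact: iky.
split.
  have := integrable_fubini_F if_; apply: eq_integrable => // x _.
  by rewrite /fubini_F /= F1.
rewrite /Rintegral; congr fine.
transitivity (\int[m1]_x \int[m2]_y (EFin \o f) (x, y))%E.
  by apply: eq_integral => x _; rewrite /= F1.
by rewrite (Fubini if_); apply: eq_integral => y _; rewrite /= F2.
Qed.

End Fubini_kernel.

(** * Monotone maps and their generalized inverses *)

Section monotone_rearrangement.
Context {R : realType}.
Local Notation mu := (@lebesgue_measure R).
Local Notation Omega := (@Omega R).
Implicit Types (X u psi : R -> R) (k x y m : R).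

Lemma measurable_fun_natr_bool d (T : measurableType d) (D : set T) (b : T -> bool) :
  measurable_fun D b -> measurable_fun D (fun t => (b t)%:R : R).
Proof.
move=> mb mD; rewrite (_ : (fun t => _) = (fun t => if b t then 1 else 0)).
  by apply: measurable_fun_if.
by apply/funext => t; case: (b t).
Qed.

Lemma sgr_subE k m : Num.sg (k - m) = (m < k)%R%:R - (k < m)%R%:R :> R.
Proof.
case: (ltgtP m k) => [mk|km|->]; last by rewrite subrr sgr0 subr0.
  by rewrite gtr0_sg ?subr_gt0// subr0.
by rewrite ltr0_sg ?subr_lt0// sub0r.
Qed.

Lemma norm_sgr_le1 x : `|Num.sg x| <= 1.
Proof. by rewrite normr_sg; case: (x != 0). Qed.

Lemma measurable_sgr_sub D k : measurable_fun D (fun m => Num.sg (k - m)).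
Proof.
rewrite (_ : (fun m => _) = (fun m => (m < k)%R%:R - (k < m)%R%:R)).
  apply: measurable_funB; apply: measurable_fun_natr_bool; exact: measurable_fun_ltr.
by apply/funext => m; exact: sgr_subE.
Qed.

Lemma measurable_sublevel X x : inK X -> measurable (Omega `&` [set m | X m <= x]).
Proof.
move=> [[mX _] _].
have -> : Omega `&` [set m | X m <= x] = Omega `&` X @^-1` `]-oo, x].
  by apply/seteqP; split => m /= [Om h]; split => //; move: h; rewrite in_itv.
exact: (mX (@measurable_Omega R) _ (measurable_itv _)).
Qed.

Lemma fine_mu_le_itv (A : set R) (a : R) : 0 <= a -> measurable A -> A `<=` `]0, a] ->
  fine (mu A) <= a.
Proof.
move=> a0 mA Aa; have := le_measure mu (mem_set mA) (mem_set (measurable_itv `]0, a])) Aa.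
rewrite /= lebesgue_measure_itv /= => h; rewrite -lee_fin.
case: ifPn h => [|_]; last first.
  by rewrite measure_le0 => /eqP -> /=; rewrite lee_fin.
rewrite sube0 => _ h; rewrite fineK// ge0_fin_numE ?measure_ge0//.
by apply: le_lt_trans h _; rewrite ltry.
Qed.

Lemma fine_mu_ge_itv (A : set R) (a : R) : measurable A -> A `<=` Omega ->
  `]0, a[ `<=` A -> a <= fine (mu A).
Proof.
move=> mA AO Aa; have [a0|a0] := leP a 0.
  by apply: le_trans a0 _; rewrite fine_ge0.
have := le_measure mu (mem_set (measurable_itv `]0, a[)) (mem_set mA) Aa.
rewrite /= lebesgue_measure_itv /= lte_fin a0 sube0 => h.
rewrite -lee_fin fineK// ge0_fin_numE ?measure_ge0//.
have := le_measure mu (mem_set mA) (mem_set (@measurable_Omega R)) AO.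
by rewrite /= [leRHS]mu_Omega => /le_lt_trans; apply; rewrite ltry.
Qed.

Lemma gen_inv_ge0 X x : 0 <= gen_inv X x.
Proof. by rewrite fine_ge0// measure_ge0. Qed.

Lemma gen_inv_le1 X x : inK X -> gen_inv X x <= 1.
Proof.
move=> KX; apply: fine_mu_le_itv => //; first exact: measurable_sublevel.
by move=> m [+ _]; rewrite /Defs.Omega /= !in_itv /= => /andP[-> /ltW ->].
Qed.

(** If [X m > x], monotonicity confines the sublevel set to []0, m]], so its measure is at most [m].
    Together with [le_gen_inv] this replaces a Galois connection: [X] is an arbitrary monotone
    representative, so the point [m = gen_inv X x] stays undecided. *)
Lemma le_of_lt_gen_inv X x m : inK X -> Omega m -> m < gen_inv X x -> X m <= x.
Proof.
move=> KX Om mM; rewrite leNgt; apply/negP => xX.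
suff : gen_inv X x <= m by rewrite leNgt mM.
have m0 : 0 <= m by move: Om; rewrite /Defs.Omega /= in_itv /= => /andP[/ltW].
apply: fine_mu_le_itv => //; first exact: measurable_sublevel.
move=> n [On Xn]; move: (On); rewrite /Defs.Omega /= !in_itv /= => /andP[-> _] /=.
rewrite leNgt; apply/negP => mn.
have := KX.2 m n (mem_set Om) (mem_set On) (ltW mn).
by rewrite leNgt (le_lt_trans Xn xX).
Qed.

Lemma le_gen_inv X x m : inK X -> Omega m -> X m <= x -> m <= gen_inv X x.
Proof.
move=> KX Om Xm; apply: fine_mu_ge_itv; first exact: measurable_sublevel.
  by move=> ? [].
move=> n; rewrite /= in_itv /= => /andP[n0 /ltW nm].
have On : Omega n.
  move: Om; rewrite /Defs.Omega /= !in_itv /= => /andP[_ m1].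
  by rewrite n0 (le_lt_trans nm m1).
by split => //; apply: le_trans Xm; apply: KX.2 => //; exact: mem_set.
Qed.

Lemma gen_inv_nd X x y : inK X -> x <= y -> gen_inv X x <= gen_inv X y.
Proof.
move=> KX xy; rewrite /gen_inv fine_le//.
- rewrite ge0_fin_numE ?measure_ge0//.
  have := le_measure mu (mem_set (measurable_sublevel x KX)) (mem_set (@measurable_Omega R)) (@subIsetl _ _ _).
  by rewrite /= [leRHS]mu_Omega => /le_lt_trans; apply; rewrite ltry.
- rewrite ge0_fin_numE ?measure_ge0//.
  have := le_measure mu (mem_set (measurable_sublevel y KX)) (mem_set (@measurable_Omega R)) (@subIsetl _ _ _).
  by rewrite /= [leRHS]mu_Omega => /le_lt_trans; apply; rewrite ltry.
- apply: le_measure; rewrite ?inE; [exact: measurable_sublevel..|].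
  by move=> m [Om Xm]; split => //; apply: le_trans Xm xy.
Qed.

Lemma eq_Rintegral_off2 (f g : R -> R) (a b : R) :
  measurable_fun Omega f -> measurable_fun Omega g ->
  (forall m, Omega m -> m != a -> m != b -> f m = g m) ->
  \int[mu]_(m in Omega) f m = \int[mu]_(m in Omega) g m.
Proof.
move=> mf mg fg; rewrite /Rintegral; congr fine.
have mO := @measurable_Omega R.
have mOa : measurable (Omega `\ a) by apply: measurableD => //; exact: measurable_set1.
have mOab : measurable ((Omega `\ a) `\ b) by apply: measurableD => //; exact: measurable_set1.
have off (h : R -> R) : measurable_fun Omega h ->
    (\int[mu]_(m in Omega) (h m)%:E = \int[mu]_(m in (Omega `\ a) `\ b) (h m)%:E)%E.
  move=> mh; rewrite (integral_setD1 mOab); last first.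
    by apply/measurable_EFinP; apply: measurable_funS mh => // m [[]].
  rewrite (integral_setD1 mOa)//.
  by apply/measurable_EFinP; apply: measurable_funS mh => // m [].
rewrite !off//; apply: eq_integral => m /set_mem [[Om /= /eqP ma] /eqP mb].
by rewrite fg.
Qed.

(** [calU U t k] is convertible to [cumul (U t) k]. For [u = 1] this is the truncation of [k] to
    [[0, 1]]. *)
Definition cumul u k := \int[mu]_(m in Omega `&` `]0, k]) u m.

Lemma cumulE u k : cumul u k = \int[mu]_(m in Omega) (u m * (m <= k)%R%:R).
Proof.
rewrite /cumul Rintegral_mkcondr; apply: eq_Rintegral => m /set_mem.
rewrite /Defs.Omega /= patchE mem_setE !in_itv /= => /andP[-> _] /=.
by case: (m <= k); rewrite ?mulr1 ?mulr0.
Qed.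

(** Up to two points [m], this is the indicator of the interval between [k] and [gen_inv X x]. It is
    written so that [x] occurs only in [x < X m], which integrates in [x] to a primitive evaluated
    at [X m]. *)
Definition entropy_kernel k X x m := Num.sg (k - m) * (x < X m)%R%:R + (k < m)%R%:R.

Lemma norm_kernel_le2 k X x m : `|entropy_kernel k X x m| <= 2.
Proof.
rewrite (le_trans (ler_normD _ _))// [leRHS](_ : _ = 1 + 1)// lerD//.
  by rewrite normrM mulr_ile1//; [exact: norm_sgr_le1|case: (x < X m); rewrite ?normr1 ?normr0].
by case: (k < m); rewrite ?normr1 ?normr0.
Qed.

Lemma measurable_kernel k X x : measurable_fun Omega X ->
  measurable_fun Omega (entropy_kernel k X x).
Proof.
move=> mX; apply: measurable_funD; last first.
  by apply: measurable_fun_natr_bool; exact: measurable_fun_ltr.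
apply: measurable_funM; first exact: measurable_sgr_sub.
by apply: measurable_fun_natr_bool; exact: measurable_fun_ltr.
Qed.

Lemma measurable_le_natr (D : set R) k : measurable_fun D (fun m => (m <= k)%R%:R : R).
Proof. by apply: measurable_fun_natr_bool; exact: measurable_fun_ler. Qed.

(* The sublevel set [X <= x] is, up to one point, the interval ]0, M(x)]. *)
Lemma flux_kernel X u k x : inK X -> L2 u ->
  Num.sg (gen_inv X x - k) * (cumul u (gen_inv X x) - cumul u k) =
  \int[mu]_(m in Omega) (u m * entropy_kernel k X x m).
Proof.
move=> KX Lu; set M := gen_inv X x.
have Lle a : L2 (fun m => u m * (m <= a)%R%:R).
  apply: (@L2M_bounded _ _ _ 1) => //; first exact: measurable_le_natr.
  by move=> m _; case: (m <= a); rewrite ?normr1 ?normr0.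
rewrite !cumulE -RintegralB//; [|exact: L2_integrable (Lle _)..].
rewrite -RintegralZl//; last exact: (L2_integrable (L2B (Lle M) (Lle k))).
(* The two endpoints of the interval are excluded: at [M] the comparison of [x] with [X m] is
   undecided, and at [k] the sign vanishes. *)
apply: (@eq_Rintegral_off2 _ _ M k).
- apply: measurable_funM => //; exact: (L2B (Lle M) (Lle k)).1.
- by apply: measurable_funM; [exact: Lu.1|apply: measurable_kernel; exact: KX.1.1].
move=> m Om mM mk; rewrite -mulrBr mulrCA; congr (u m * _).
rewrite /entropy_kernel; have -> : (x < X m) = (M < m).
  have := @le_gen_inv X x m KX Om; have := @le_of_lt_gen_inv X x m KX Om.
  rewrite -/M; case: (ltgtP m M) mM => // _ _ Hlt Hle.
    by rewrite ltNge Hlt.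
  by rewrite ltNge; apply/negP => /Hle.
rewrite !sgr_subE; move: mM mk.
by case: (ltgtP m M); case: (ltgtP m k); case: (ltgtP k M) => //=; try lra.
Qed.

End monotone_rearrangement.

(** * Primitives and the exchange of integrals *)

Section lowint.
Context {R : realType}.
Local Notation mu := (@lebesgue_measure R).
Local Notation Omega := (@Omega R).
Implicit Types (X u f psi : R -> R) (k x y m : R).

Definition lowint psi y := \int[mu]_(x in `]-oo, y]) psi x.

Lemma integrable_setT psi (D : set R) : mu.-integrable setT (EFin \o psi) ->
  measurable (D : set (measurableTypeR R)) -> mu.-integrable D (EFin \o psi).
Proof. by move=> ipsi mD; apply: integrableS ipsi. Qed.

Lemma lowintB psi (a b : R) : mu.-integrable setT (EFin \o psi) -> a <= b ->
  lowint psi b - lowint psi a = \int[mu]_(x in `]a, b]) psi x.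
Proof.
move=> ipsi ab; rewrite /lowint Rintegral_itvB ?bnd_simp//.
exact: integrable_setT.
Qed.

Lemma fine_mu_itv_oc (a b : R) : a <= b -> fine (mu `]a, b]) = b - a.
Proof.
move=> ab; rewrite lebesgue_measure_itv /= lte_fin.
by case: ltgtP ab => //= -> _; rewrite subrr.
Qed.

Lemma norm_Rintegral_itv_le psi (C a b : R) : mu.-integrable `]a, b] (EFin \o psi) -> a <= b ->
  (forall x, a < x <= b -> `|psi x| <= C) ->
  `|\int[mu]_(x in `]a, b]) psi x| <= C * (b - a).
Proof.
move=> iab ab psiC.
apply: le_trans (le_normr_Rintegral _ iab) _ => //.
rewrite -(fine_mu_itv_oc ab) -Rintegral_cst//; apply: le_Rintegral => //.
- exact: integrable_norm.
- apply: (@measurable_bounded_integrable _ _ _ mu) => //.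
    by rewrite /= lebesgue_measure_itv /=; case: ifP; rewrite ltry.
  by exists `|C|; split; [exact: num_real|move=> y cy x /= _; exact: ltW].
Qed.

Lemma lowint_lip psi (C a b : R) : mu.-integrable setT (EFin \o psi) ->
  (forall x, `|psi x| <= C) -> `|lowint psi b - lowint psi a| <= C * `|b - a|.
Proof.
move=> ipsi psiC; wlog ab : a b / a <= b => [H|].
  have [/H//|/ltW/H] := leP a b.
  by rewrite distrC (distrC a).
rewrite lowintB// (ger0_norm (x := b - a)) ?subr_ge0//.
by apply: norm_Rintegral_itv_le => //; exact: integrable_setT.
Qed.

Lemma lip_ge0 f (C : R) : (forall x y, `|f y - f x| <= C * `|y - x|) -> 0 <= C.
Proof. by move=> fC; have := le_trans (normr_ge0 _) (fC 0 1); rewrite subr0 normr1 mulr1. Qed.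

Lemma lip_on_continuous (D : set R) f (C : R) : 0 <= C ->
  (forall s t, D s -> D t -> `|f t - f s| <= C * `|t - s|) -> {within D, continuous f}.
Proof.
move=> C0 fC; have C1 : 0 < C + 1 by rewrite ltr_wpDl.
apply/subspace_continuousP => s Ds; apply/cvgrPdist_le => /= e e0.
apply/nbhs_ballP; exists (e / (C + 1)) => /=; first by rewrite divr_gt0.
move=> t /= /ltW st Dt; apply: le_trans (fC _ _ Dt Ds) _.
apply: (@le_trans _ _ ((C + 1) * (e / (C + 1)))); last by rewrite mulrC divfK// gt_eqF.
by apply: ler_pM => //; rewrite lerDl.
Qed.

Lemma lip_continuous f (C : R) : (forall x y, `|f y - f x| <= C * `|y - x|) -> continuous f.
Proof.
move=> fC; apply/continuous_subspace_setT.
by apply: (lip_on_continuous (lip_ge0 fC)) => s t _ _; exact: fC.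
Qed.

Lemma lip_measurable f (C : R) (D : set R) :
  (forall x y, `|f y - f x| <= C * `|y - x|) -> measurable_fun D f.
Proof.
move=> fC; apply: (@measurable_funS _ _ _ _ setT) => //.
exact: continuous_measurable_fun (lip_continuous fC).
Qed.

(** The endpoint [y] is dropped to match the strict comparison [x < X m] in [entropy_kernel]. *)
Lemma lowintE psi y : mu.-integrable setT (EFin \o psi) ->
  lowint psi y = \int[mu]_x (psi x * (x < y)%R%:R).
Proof.
move=> ipsi; rewrite /lowint -Rintegral_itv_bndo_bndc; last exact: integrable_setT.
rewrite Rintegral_mkcond; apply: eq_Rintegral => x _; rewrite patchE mem_setE in_itv /=.
by case: (x < y); rewrite ?mulr1 ?mulr0.
Qed.

Lemma integrable_natr_lt psi y : mu.-integrable setT (EFin \o psi) ->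
  mu.-integrable setT (EFin \o (fun x => psi x * (x < y)%R%:R)).
Proof.
move=> ipsi; have := ipsi; apply: le_integrable => //.
  apply/measurable_EFinP/measurable_funM.
    by apply/measurable_EFinP; exact: (measurable_int mu ipsi).
  by apply: measurable_fun_natr_bool; exact: measurable_fun_ltr.
move=> x _ /=; rewrite lee_fin normrM ler_piMr//.
by case: (x < y); rewrite ?normr1 ?normr0.
Qed.

Lemma measurable_entropy_kernel k X : measurable_fun setT X ->
  measurable_fun setT
    (fun p : measurableTypeR R * measurableTypeR R => entropy_kernel k X p.1 p.2).
Proof.
move=> mX.
have m1 : measurable_fun setT (fun p : measurableTypeR R * measurableTypeR R => p.1 : R).
  exact: measurable_fst.
have m2 : measurable_fun setT (fun p : measurableTypeR R * measurableTypeR R => p.2 : R).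
  exact: measurable_snd.
apply: measurable_funD; last first.
  by apply: measurable_fun_natr_bool; exact: measurable_fun_ltr.
have msg := @measurable_sgr_sub R setT k.
apply: measurable_funM; first exact: (measurableT_comp msg m2).
apply: measurable_fun_natr_bool; apply: measurable_fun_ltr => //.
exact: (measurableT_comp mX m2).
Qed.

(** The kernel is integrated in [x] first: its indicator produces [lowint psi (X m)], a Lipschitz
    function of [X m], and its second term produces a multiple of the total integral of [psi] that
    does not depend on [X]. *)
Lemma kernel_integral X u psi (C : R) k : inK X -> L2 u ->
  mu.-integrable setT (EFin \o psi) -> (forall x, `|psi x| <= C) ->
  mu.-integrable setT (EFin \o (fun x => psi x *
    (Num.sg (gen_inv X x - k) * (cumul u (gen_inv X x) - cumul u k)))) /\
  \int[mu]_x (psi x *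
    (Num.sg (gen_inv X x - k) * (cumul u (gen_inv X x) - cumul u k))) =
  inner u (fun m => Num.sg (k - m) * lowint psi (X m)) +
  inner u (fun m => (k < m)%R%:R) * \int[mu]_x psi x.
Proof.
move=> KX Lu ipsi psiC; have mX := KX.1.1.
have mO := @measurable_Omega R.
(* Extension by zero, since the exchange of integrals is carried out on the whole line; where [v]
   vanishes the value of [Y] is irrelevant. *)
pose Y := X \_ Omega; pose v := u \_ Omega.
have iv : mu.-integrable setT (EFin \o v).
  have := L2_integrable Lu; rewrite integrable_mkcond//.
  by apply: eq_integrable => // x _; rewrite /v /= !patchE; case: ifP.
have mY : measurable_fun setT Y by exact: ((measurable_restrictT X mO).1 mX).
have vkap x : \int[mu]_m (v m * entropy_kernel k Y x m) =
    Num.sg (gen_inv X x - k) * (cumul u (gen_inv X x) - cumul u k).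
  rewrite flux_kernel// [RHS]Rintegral_mkcond; apply: eq_Rintegral => m _.
  by rewrite /v /entropy_kernel /Y !patchE; case: ifP => // _; rewrite mul0r.
have [i1] := Fubini_kernel ipsi iv (measurable_entropy_kernel k mY) (norm_kernel_le2 k Y).
move=> e1; split; first by apply: eq_integrable i1 => [//|x _ /=]; rewrite vkap.
transitivity (\int[mu]_x (psi x * \int[mu]_m (v m * entropy_kernel k Y x m))).
  by apply: eq_Rintegral => x _; rewrite vkap; reflexivity.
rewrite {}e1 !innerE => {i1 vkap}.
have low_bd y : `|lowint psi y| <= fine (\int[mu]_x `|psi x|)%R%:E.
  rewrite lowintE//; apply: le_trans (le_normr_Rintegral _ (integrable_natr_lt y ipsi)) _ => //.
  apply: le_Rintegral => //; [exact: integrable_norm (integrable_natr_lt _ _)|exact: integrable_norm|].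
  move=> x _; rewrite normrM ler_piMr//.
  by case: (x < y); rewrite ?normr1 ?normr0.
rewrite -RintegralZr//; last first.
  apply: L2_integrable; apply: (@L2M_bounded _ _ _ 1) => //.
    by apply: measurable_fun_natr_bool; exact: measurable_fun_ltr.
  by move=> m _; case: (k < m); rewrite ?normr1 ?normr0.
rewrite -RintegralD//; last 2 first.
- apply: L2_integrable; apply: (L2M_bounded (c := fine (\int[mu]_x `|psi x|)%R%:E)) => //.
    apply: measurable_funM; first exact: measurable_sgr_sub.
    apply: (measurableT_comp _ mX); exact: lip_measurable (fun x y => lowint_lip x y ipsi psiC).
  move=> m _; rewrite normrM (le_trans _ (low_bd (X m)))// ler_piMl//.
  exact: norm_sgr_le1.
- apply: L2_integrable; rewrite /=.
  under eq_fun do rewrite -mulrA; apply: (@L2M_bounded _ _ _ `|\int[mu]_x psi x|) => //.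
    apply: measurable_funM => //.
    by apply: measurable_fun_natr_bool; exact: measurable_fun_ltr.
  by move=> m _; rewrite normrM; case: (k < m); rewrite ?normr1 ?normr0 ?mul1r ?mul0r.
rewrite [RHS]Rintegral_mkcond; apply: eq_Rintegral => m _.
rewrite /v !patchE; case: ifPn => [Om|_]; last by rewrite mul0r.
have -> : \int[mu]_x (psi x * entropy_kernel k Y x m) =
    \int[mu]_x (Num.sg (k - m) * (psi x * (x < X m)%R%:R) + (k < m)%R%:R * psi x).
  by apply: eq_Rintegral => x _; rewrite /entropy_kernel /Y patchE Om; ring.
have i2 := integrable_natr_lt (X m) ipsi.
rewrite RintegralD//; last 2 first.
- by have := integrableZl measurableT (Num.sg (k - m)) i2.
- by have := integrableZl measurableT (k < m)%R%:R ipsi.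
by rewrite !RintegralZl// -lowintE//; ring.
Qed.
End lowint.

(** * The distance to a level and the L1 contraction *)

Section generalized_inverse.
Context {R : realType}.
Local Notation mu := (@lebesgue_measure R).
Local Notation Omega := (@Omega R).
Implicit Types (X Y u f g psi : R -> R) (k x y m : R).

Lemma measurable_Omega_oc k : measurable (Omega `&` `]0, k] : set (measurableTypeR R)).
Proof. exact: measurableI (@measurable_Omega R) (measurable_itv _). Qed.

Lemma cumul1E k : cumul (fun=> 1) k = fine (mu (Omega `&` `]0, k])).
Proof.
rewrite /cumul Rintegral_cst ?mul1r//.
exact: measurable_Omega_oc.
Qed.

Lemma cumul1_id k : 0 <= k <= 1 -> cumul (fun=> 1) k = k.
Proof.
move=> /andP[k0 k1]; rewrite cumul1E; apply/eqP; rewrite eq_le; apply/andP; split.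
  by apply: fine_mu_le_itv => [//||? []//]; exact: measurable_Omega_oc.
apply: fine_mu_ge_itv; [exact: measurable_Omega_oc|by move=> ? []|].
move=> m; rewrite /Defs.Omega /= !in_itv /= => /andP[-> mk].
by rewrite (lt_le_trans mk k1) (ltW mk).
Qed.

Lemma cumul1_le0 k : k <= 0 -> cumul (fun=> 1) k = 0.
Proof.
move=> k0; rewrite cumul1E [X in mu X](_ : _ = set0) ?measure0//.
by rewrite -subset0 => m [] _ /=; rewrite in_itv /= => /andP[/lt_le_trans h /h /(le_lt_trans k0)]; rewrite ltxx.
Qed.

Lemma cumul1_ge1 k : 1 <= k -> cumul (fun=> 1) k = 1.
Proof.
move=> k1; rewrite cumul1E [X in mu X](_ : _ = Omega).
  by rewrite [X in fine X]mu_Omega.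
apply/seteqP; split => [m []//|m Om]; split => //.
move: Om; rewrite /Defs.Omega /= !in_itv /= => /andP[-> /ltW m1].
exact: le_trans m1 k1.
Qed.

(** The inverse takes values in [[0, 1]], where truncation is the identity. So for [k] outside
    [[0, 1]] the distance to [k] is the distance to the truncated level plus the distance from [k]
    to [[0, 1]]. This admits every real [k]. *)
Lemma abs_gen_inv X x k : inK X ->
  `|gen_inv X x - k| =
  Num.sg (gen_inv X x - k) * (cumul (fun=> 1) (gen_inv X x) - cumul (fun=> 1) k)
  + `|k - cumul (fun=> 1) k|.
Proof.
move=> KX; have M0 := gen_inv_ge0 X x; have M1 := gen_inv_le1 x KX.
rewrite (cumul1_id (k := gen_inv X x)) ?M0//; move: (gen_inv X x) M0 M1 => M M0 M1.
have [k0|k0] := ltP k 0.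
  rewrite cumul1_le0 ?(ltW k0)// !subr0 gtr0_sg ?mul1r; last lra.
  by rewrite ger0_norm ?ltr0_norm//; lra.
have [k1|k1] := ltP 1 k.
  rewrite cumul1_ge1 ?(ltW k1)// ltr0_sg; last lra.
  by rewrite ltr0_norm ?gtr0_norm; lra.
by rewrite cumul1_id ?k0// subrr normr0 addr0 -normrEsg.
Qed.

(** The measure of the part of [Omega] above [k] plus the distance from [k] to [[0, 1]]. This adds
    up to [|1 - k|], the limit of [|gen_inv X x - k|] as [x] tends to [+oo]. *)
Definition abs_coeff k := inner (fun=> 1) (fun m => (k < m)%R%:R) + `|k - cumul (fun=> 1) k|.

Lemma abs_gen_inv_integral X psi (C : R) k : inK X ->
  mu.-integrable setT (EFin \o psi) -> (forall x, `|psi x| <= C) ->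
  mu.-integrable setT (EFin \o (fun x => `|gen_inv X x - k| * psi x)) /\
  \int[mu]_x (`|gen_inv X x - k| * psi x) =
  inner (fun=> 1) (fun m => Num.sg (k - m) * lowint psi (X m)) +
  abs_coeff k * \int[mu]_x psi x.
Proof.
move=> KX ipsi psiC.
have [i1] := kernel_integral k KX (L2_cst 1) ipsi psiC.
have absE x : `|gen_inv X x - k| * psi x =
    psi x * (Num.sg (gen_inv X x - k) * (cumul (fun=> 1) (gen_inv X x) - cumul (fun=> 1) k))
    + `|k - cumul (fun=> 1) k| * psi x by rewrite (abs_gen_inv _ _ KX); ring.
have i2 : mu.-integrable setT (EFin \o (fun x => `|k - cumul (fun=> 1) k| * psi x)).
  by have := integrableZl measurableT `|k - cumul (fun=> 1) k| ipsi.
move=> e1; split.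
  have := integrableD measurableT i1 i2.
  by apply: eq_integrable => [//|x _ /=]; rewrite absE.
under eq_Rintegral do rewrite absE.
rewrite RintegralD ?{}e1; [|by []|exact: i1|exact: i2].
by rewrite RintegralZl; [rewrite /abs_coeff; ring|by []|exact: ipsi].
Qed.

Lemma L2_sgM f k : L2 f -> L2 (fun m => Num.sg (k - m) * f m).
Proof.
move=> Lf; apply: (L2_le_norm _ Lf).
  by apply: measurable_funM; [exact: measurable_sgr_sub|exact: Lf.1].
by move=> m _; rewrite normrM ler_piMl//; exact: norm_sgr_le1.
Qed.

Lemma inner_sgM_le u f k : L2 u -> L2 f ->
  `|inner u (fun m => Num.sg (k - m) * f m)| <= norm2 u * norm2 f.
Proof.
move=> Lu Lf; apply: le_trans (cauchy_schwarz Lu (L2_sgM k Lf)) _.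
rewrite ler_wpM2l ?norm2_ge0//; apply: le_norm2 => //; first exact: L2_sgM.
by move=> m _; rewrite normrM ler_piMl//; exact: norm_sgr_le1.
Qed.

Lemma inner_sgMB u f g k : L2 u -> L2 f -> L2 g ->
  inner u (fun m => Num.sg (k - m) * f m) - inner u (fun m => Num.sg (k - m) * g m) =
  inner u (fun m => Num.sg (k - m) * (f m - g m)).
Proof.
move=> Lu Lf Lg; rewrite -innerBr//; [|exact: L2_sgM..].
by apply: eq_inner => m _; congr (u m * _); rewrite mulrBr.
Qed.

Lemma L2_lip f (C : R) X : (forall x y, `|f y - f x| <= C * `|y - x|) ->
  L2 X -> L2 (fun m => f (X m)).
Proof.
move=> fC LX; have C0 : 0 <= C := lip_ge0 fC.
apply: (L2_le_norm _ (L2D (L2_cst `|f 0|) (L2Z C (L2_norm LX)))).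
  by apply: (measurableT_comp _ LX.1); exact: lip_measurable fC.
move=> m _; rewrite [leRHS]ger0_norm ?addr_ge0 ?mulr_ge0//.
have := fC 0 (X m); rewrite subr0 => h.
by rewrite -(subrK (f 0) (f (X m))) (le_trans (ler_normD _ _))// addrC lerD2l.
Qed.

Lemma norm2_lip f (C : R) X Y : (forall x y, `|f y - f x| <= C * `|y - x|) ->
  L2 X -> L2 Y -> norm2 (fun m => f (X m) - f (Y m)) <= C * norm2 (fun m => X m - Y m).
Proof.
move=> fC LX LY; have C0 : 0 <= C := lip_ge0 fC.
have -> : C * norm2 (fun m => X m - Y m) = norm2 (fun m => C * (X m - Y m)).
  apply/eqP; rewrite -(@eqrXn2 _ 2) ?mulr_ge0 ?norm2_ge0// exprMn !norm2_sqr.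
  have LXY := L2B LX LY.
  by rewrite innerZl// ?(innerC (fun m => X m - Y m)) ?innerZl ?mulrA//; exact: L2Z.
apply: le_norm2; [exact: L2B (L2_lip fC LX) (L2_lip fC LY)|exact: L2Z (L2B LX LY)|].
by move=> m _; rewrite normrM (ger0_norm C0); exact: fC.
Qed.

Lemma measurable_sgr_fun d (T : measurableType d) (D : set T) (F : T -> R) :
  measurable_fun D F -> measurable_fun D (fun t => Num.sg (F t)).
Proof.
move=> mF; rewrite (_ : (fun t => _) = (fun t => (0 < F t)%R%:R - (F t < 0)%R%:R)).
  apply: measurable_funB; apply: measurable_fun_natr_bool; exact: measurable_fun_ltr.
by apply/funext => t; have := sgr_subE (F t) 0; rewrite subr0.
Qed.

Lemma measurable_gen_inv X D : inK X -> measurable D -> measurable_fun D (gen_inv X).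
Proof.
by move=> KX mD; apply: nondecreasing_measurable => // x y xy; exact: gen_inv_nd.
Qed.

(** By duality: with [psi] the sign of the difference on [[a, b]], the left side becomes a
    difference of pairings with [lowint psi (X m)] and [lowint psi (Y m)], and [lowint psi] is
    1-Lipschitz. The terms with the total integral of [psi] cancel. *)
Lemma gen_inv_contraction X Y (a b : R) : inK X -> inK Y ->
  \int[mu]_(x in `[a, b]) `|gen_inv X x - gen_inv Y x| <= norm2 (fun m => X m - Y m).
Proof.
move=> KX KY.
pose psi x := Num.sg (gen_inv X x - gen_inv Y x) * (x \in `[a, b])%:R.
have psi1 x : `|psi x| <= 1.
  rewrite normrM mulr_ile1//; first exact: norm_sgr_le1.
  by case: (x \in _); rewrite ?normr1 ?normr0.
have psiE : psi = (fun x => Num.sg (gen_inv X x - gen_inv Y x)) \_ `[a, b].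
  by apply/funext => x; rewrite /psi patchE mem_setE; case: (x \in _); rewrite ?mulr1 ?mulr0.
have ipsi : mu.-integrable setT (EFin \o psi).
  have mab : measurable (`[a, b] : set (measurableTypeR R)) by exact: measurable_itv.
  have : mu.-integrable `[a, b] (EFin \o (fun x => Num.sg (gen_inv X x - gen_inv Y x))).
    apply: (@measurable_bounded_integrable _ _ _ mu) => //.
    - by rewrite /= lebesgue_measure_itv /=; case: ifP => _; rewrite ltry.
    - by apply: measurable_sgr_fun; apply: measurable_funB; exact: measurable_gen_inv.
    - exists 1; split; [exact: num_real|move=> y y1 x /= _]; apply: le_trans (ltW y1).
      exact: norm_sgr_le1.
  by rewrite integrable_mkcond//; apply: eq_integrable => // x _; rewrite psiE /= !patchE; case: ifP.
have [iX] := abs_gen_inv_integral 0 KX ipsi psi1.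
have [iY] := abs_gen_inv_integral 0 KY ipsi psi1.
move=> eY eX.
have -> : \int[mu]_(x in `[a, b]) `|gen_inv X x - gen_inv Y x| =
    \int[mu]_x (`|gen_inv X x - 0| * psi x) - \int[mu]_x (`|gen_inv Y x - 0| * psi x).
  rewrite -RintegralB; [|exact: measurableT|exact: iX|exact: iY].
  rewrite Rintegral_mkcond; apply: eq_Rintegral => x _.
  rewrite !subr0 !ger0_norm ?gen_inv_ge0// -mulrBl patchE /psi mem_setE.
  by case: (x \in _); rewrite ?mulr1 ?mulr0// normrEsg mulrC; reflexivity.
have addrBr (p q r : R) : p + r - (q + r) = p - q by ring.
rewrite {}eX {}eY {iX iY} addrBr.
have Clow : forall x y, `|lowint psi y - lowint psi x| <= 1 * `|y - x|.
  by move=> x y; exact: lowint_lip.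
rewrite inner_sgMB; [|exact: L2_cst|exact: L2_lip Clow KX.1|exact: L2_lip Clow KY.1].
apply: le_trans (ler_norm _) _; apply: le_trans (inner_sgM_le _ _ _) _; first exact: L2_cst.
  by apply: L2B; [exact: L2_lip Clow KX.1|exact: L2_lip Clow KY.1].
rewrite norm2_cst normr1 mul1r; apply: le_trans (norm2_lip Clow KX.1 KY.1) _.
by rewrite mul1r.
Qed.

(** Right continuity in [x]. A mass [m] strictly between [gen_inv X x] and [c] has [X m > x], and
    the inverse is at most [m] at every point strictly between [x] and [X m]. *)
Lemma gen_inv_right_lt X x (c : R) : inK X -> gen_inv X x < c ->
  exists2 y, x < y & gen_inv X y < c.
Proof.
(* The case [c <= 1] guarantees that the mass [m] chosen below lies in [Omega]. *)
move=> KX Mc; have [c1|c1] := ltP 1 c.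
  by exists (x + 1); [rewrite ltrDl|apply: le_lt_trans (gen_inv_le1 _ KX) c1].
pose m := (gen_inv X x + c) / 2.
have M0 := gen_inv_ge0 X x.
have Mm : gen_inv X x < m by rewrite /m; lra.
have mc : m < c by rewrite /m; lra.
have Om : Omega m by rewrite /Defs.Omega /= in_itv /=; apply/andP; split; lra.
have xX : x < X m by rewrite ltNge; apply/negP => /(le_gen_inv KX Om); rewrite leNgt Mm.
exists ((x + X m) / 2); first lra.
apply: le_lt_trans mc; rewrite leNgt; apply/negP => /(le_of_lt_gen_inv KX Om); lra.
Qed.

End generalized_inverse.

(** * Measurability and L1 continuity of the curve of inverses *)

Section time_regularity.
Context {R : realType}.
Local Notation mu := (@lebesgue_measure R).
Local Notation Omega := (@Omega R).
Implicit Types (X : R -> R -> R).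

Lemma fine_mu_itv_cc (a b : R) : a <= b -> fine (mu `[a, b]) = b - a.
Proof.
move=> ab; rewrite lebesgue_measure_itv /= lte_fin.
by case: ltgtP ab => //= -> _; rewrite subrr.
Qed.

Lemma gen_inv_integrable_dist (Y Z : R -> R) (a b : R) : inK Y -> inK Z ->
  mu.-integrable `[a, b] (EFin \o (fun x => `|gen_inv Y x - gen_inv Z x|)).
Proof.
move=> KY KZ.
have mab : measurable (`[a, b] : set (measurableTypeR R)) by exact: measurable_itv.
apply: (@measurable_bounded_integrable _ _ _ mu) => //.
- by rewrite /= lebesgue_measure_itv /=; case: ifP => _; rewrite ltry.
- by apply: measurableT_comp => //; apply: measurable_funB; exact: measurable_gen_inv.
- exists 1; split; [exact: num_real|move=> y y1 x /= _]; apply: le_trans (ltW y1).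
  have := gen_inv_ge0 Y x; have := gen_inv_ge0 Z x.
  have := gen_inv_le1 x KY; have := gen_inv_le1 x KZ.
  by rewrite normr_id ler_norml => *; apply/andP; split; lra.
Qed.

(** The L1 contraction says nothing at a single point. By monotonicity in [x], the integrand on
    [[q, r]] is at least [gen_inv Y q - gen_inv Z r], which gives a pointwise bound at the price of
    a shift from [q] to [r]. *)
Lemma gen_inv_shift (Y Z : R -> R) (q r : R) : inK Y -> inK Z -> q < r ->
  (gen_inv Y q - gen_inv Z r) * (r - q) <= norm2 (fun m => Y m - Z m).
Proof.
move=> KY KZ qr; apply: le_trans (gen_inv_contraction q r KY KZ).
have mqr : measurable (`[q, r] : set (measurableTypeR R)) by exact: measurable_itv.
rewrite -(fine_mu_itv_cc (ltW qr)) -Rintegral_cst//; apply: le_Rintegral => //.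
- apply: (@measurable_bounded_integrable _ _ _ mu) => //.
    by rewrite /= lebesgue_measure_itv /=; case: ifP => _; rewrite ltry.
  by exists `|gen_inv Y q - gen_inv Z r|; split; [exact: num_real|move=> y cy x /= _; exact: ltW].
- exact: gen_inv_integrable_dist.
move=> x; rewrite /= in_itv /= => /andP[qx xr].
have := gen_inv_nd KY qx; have := gen_inv_nd KZ xr.
have := ler_norm (gen_inv Y x - gen_inv Z x); lra.
Qed.

Lemma lip_loc_bound X (S : R) : lip_loc_K X -> 0 < S -> exists2 L : R, 0 <= L &
  forall s t, 0 <= s <= S -> 0 <= t <= S -> norm2 (fun m => X t m - X s m) <= L * `|t - s|.
Proof.
move=> [_ lX] S0; have [L HL] := lX S S0; exists `|L| => // s t sS tS.
by apply: le_trans (HL s t sS tS) _; rewrite ler_wpM2r// ler_norm.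
Qed.

(** Upper semicontinuity in time at fixed [q]: right continuity provides [r > q] with value still
    below [c] at time [t], and the shift from [q] to [r] leaves room to vary the time. *)
Lemma open_gen_inv_lt X (T q c : R) : lip_loc_K X -> 0 < T ->
  open [set t | 0 < t < T /\ gen_inv (X t) q < c].
Proof.
move=> lX T0; rewrite openE => t /= [tT tc].
have KX s : 0 < s < T -> inK (X s) by move=> /andP[/ltW s0 _]; exact: lX.1.
have [r qr rc] := gen_inv_right_lt (KX t tT) tc.
have [L L0 HL] := lip_loc_bound lX T0.
have L1 : 0 < L + 1 by rewrite ltr_wpDl.
(* This radius makes [L * |s - t|] smaller than [(c - gen_inv (X t) r) * (r - q)], the gap that
   [gen_inv_shift] can absorb. *)
pose d := (c - gen_inv (X t) r) * (r - q) / (L + 1).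
have d0 : 0 < d by rewrite /d divr_gt0// mulr_gt0 ?subr_gt0.
have /andP[t0 tT'] := tT.
apply/nbhs_ballP; exists (Num.min d (Num.min t (T - t))) => /=.
  by rewrite !lt_min d0 t0 subr_gt0 tT'.
move=> s; rewrite /ball /= !lt_min => /and3P[sd st sTt].
have sT : 0 < s < T by move: st sTt; rewrite !ltr_norml => /andP[? ?] /andP[? ?]; apply/andP; split; lra.
split => //.
have h := gen_inv_shift (KX s sT) (KX t tT) qr.
have ooW u : 0 < u < T -> 0 <= u <= T by move=> /andP[/ltW -> /ltW ->].
have {HL}h := le_trans h (HL _ _ (ooW _ tT) (ooW _ sT)).
rewrite -subr_gt0 -(pmulr_lgt0 (x := r - q)); last by rewrite subr_gt0.
have : L * `|s - t| < (c - gen_inv (X t) r) * (r - q).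
  apply: (@le_lt_trans _ _ ((L + 1) * `|s - t|)); first by rewrite ler_wpM2r// lerDl.
  by rewrite mulrC -ltr_pdivlMr// distrC.
nra.
Qed.

Lemma measurable_gen_inv_curve X (T : R) : lip_loc_K X -> 0 < T ->
  measurable_fun (`]0, T[ `*` setT) (fun p : R * R => gen_inv (X p.1) p.2).
Proof.
move=> lX T0 mD; apply: (measurability _ (RGenInftyO.measurableE R)) => //.
move=> _ [_ [c ->] <-].
pose A q := [set t | 0 < t < T /\ gen_inv (X t) q < c] : set R.
(* A countable union of rectangles: right continuity supplies a rational [q > x] with value still
   below [c], and monotonicity gives the converse inclusion. *)
rewrite (_ : _ `&` _ = \bigcup_(q : rat) (A (ratr q) `*` `]-oo, (ratr q : R)[)).
  apply: bigcupT_measurable_rat => q; apply: measurableX.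
    exact: (open_measurable (@open_gen_inv_lt X T (ratr q) c lX T0)).
  exact: measurable_itv.
apply/seteqP; split => [[t x] [[/= tT _]]|[t x] [q _ [/= [tT tc]]]].
  rewrite !in_itv /= in tT *.
  move=> tc; have KX : inK (X t) by apply: lX.1; case/andP: tT => /ltW.
  have [r xr rc] := gen_inv_right_lt KX tc.
  have [q] := rat_in_itvoo xr; rewrite in_itv /= => /andP[xq qr].
  exists q => //=; split; last by rewrite in_itv.
  by split => //; apply: le_lt_trans rc; exact: gen_inv_nd (ltW qr).
rewrite !in_itv /= => xq; split; first by split => //; rewrite in_itv.
have KX : inK (X t) by apply: lX.1; case/andP: tT => /ltW.
by apply: le_lt_trans tc; exact: gen_inv_nd (ltW xq).
Qed.

Lemma gen_inv_L1_continuous X (T a b t0 : R) : lip_loc_K X -> 0 < T -> 0 <= t0 <= T ->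
  (fun t => \int[mu]_(x in `[a, b]) `|gen_inv (X t) x - gen_inv (X t0) x|)
    @ within `[0, T] (nbhs t0) --> 0.
Proof.
move=> lX T0 t0T; have [L L0 HL] := lip_loc_bound lX T0.
have L1 : 0 < L + 1 by rewrite ltr_wpDl.
apply/cvgrPdist_le => /= e e0; apply/nbhs_ballP; exists (e / (L + 1)) => /=.
  by rewrite divr_gt0.
move=> t /= tt0; rewrite in_itv /= => tT.
have KX s : 0 <= s <= T -> inK (X s) by move=> /andP[s0 _]; exact: lX.1.
rewrite sub0r normrN ger0_norm; last by apply: Rintegral_ge0.
apply: le_trans (gen_inv_contraction a b (KX _ tT) (KX _ t0T)) _.
apply: le_trans (HL _ _ t0T tT) _.
apply: (@le_trans _ _ ((L + 1) * `|t - t0|)); first by rewrite ler_wpM2r// lerDl.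
by rewrite mulrC -ler_pdivlMr// distrC ltW.
Qed.

End time_regularity.

(** * Integrating one-sided difference quotients *)

Section lipschitz_calculus.
Context {R : realType}.
Local Notation mu := (@lebesgue_measure R).
Implicit Types (F G f g : R -> R).

Lemma antiderivative G : continuous G ->
  exists Gam : R -> R, forall y : R, 0 <= y -> is_derive y 1 Gam (G y).
Proof.
(* The base point -1 makes every [y >= 0] interior, so the derivative is two-sided at 0 as well. *)
move=> cG; exists (fun y => \int[mu]_(t in `[-1, y]) G t) => y y0.
have [] := @continuous_FTC1 R G (BLeft (-1)) y (y + 1).
- by rewrite ltrDl.
- by apply: continuous_compact_integrable; [exact: segment_compact|exact: continuous_subspaceT].
- by rewrite lte_fin; lra.
- exact: cG.
by move=> d1 d2; apply: DeriveDef; [exact: d1|rewrite -derive1E; exact: d2].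
Qed.

Lemma Rintegral_derive F f (a b : R) : a <= b -> {within `[a, b], continuous f} ->
  (forall x : R, a <= x <= b -> is_derive x 1 F (f x)) ->
  \int[mu]_(x in `[a, b]) f x = F b - F a.
Proof.
rewrite le_eqVlt => /predU1P[->|ab] cf dF.
  by rewrite set_itv1 Rintegral_set1 subrr.
have cF x : a <= x <= b -> {for x, continuous F}.
  move=> axb; have := dF x axb => -[/derivable1_diffP dd _].
  exact: differentiable_continuous.
rewrite /Rintegral (@continuous_FTC2 R f F)//.
- split=> [x|| ]; first by rewrite in_itv /= => /andP[/ltW ax /ltW xb]; have [] := dF x; rewrite ?ax.
  + by apply: cvg_at_right_filter; apply: cF; rewrite lexx ltW.
  + by apply: cvg_at_left_filter; apply: cF; rewrite lexx ltW.
- move=> x; rewrite in_itv /= => /andP[/ltW ax /ltW xb].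
  by rewrite derive1E; apply: derive_val; apply: dF; rewrite ax.
Qed.

Lemma is_derive_mean F f (a b : R) : a < b ->
  (forall x : R, a <= x <= b -> is_derive x 1 F (f x)) ->
  exists2 c, a < c < b & F b - F a = f c * (b - a).
Proof.
move=> ab dF; have [||c] := @MVT R F f a b ab.
- by move=> x; rewrite in_itv /= => /andP[/ltW ax /ltW xb]; apply: dF; rewrite ax.
- apply: derivable_within_continuous => x; rewrite in_itv /= => axb.
  by have [] := dF x axb.
- by rewrite in_itv /= => cab e; exists c.
Qed.

Lemma continuous_difference_quotient G (h : R) : continuous G ->
  continuous (fun t => (G (t + h) - G t) / h).
Proof.
move=> cG x; apply: cvgM; last exact: cvg_cst.
apply: cvgB; last exact: cG.
apply: (@continuous_comp _ _ _ (fun t => t + h) G); last exact: cG.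
by apply: cvgD; [exact: cvg_id|exact: cvg_cst].
Qed.

(** The integral telescopes to the average of [G] over [[T, T + h]] minus its average over [[0, h]].
    Each average is within [L * h] of the value of [G] at the left end, hence the error
    [2 * L * h]. *)
Lemma Rintegral_difference_quotient G (T L h : R) : 0 <= T -> 0 < h ->
  (forall s t, `|G t - G s| <= L * `|t - s|) ->
  G T - G 0 - 2 * L * h <= \int[mu]_(t in `[0, T]) ((G (t + h) - G t) / h).
Proof.
move=> T0 h0 GL; have cG := lip_continuous GL.
have L0 : 0 <= L := lip_ge0 GL.
have [Gam dGam] := antiderivative cG.
(* The average of [G] over [[t, t + h]]; its derivative is the difference quotient. *)
pose F := fun t => h^-1 *: (Gam (t + h) - Gam t).
have dF (t : R) : 0 <= t -> is_derive t 1 F ((G (t + h) - G t) / h).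
  move=> t0; have -> : (G (t + h) - G t) / h = h^-1 *: (G (t + h) - G t).
    by rewrite /GRing.scale /= mulrC.
  apply: is_deriveZ; apply: is_deriveB; last exact: dGam.
  rewrite -[X in is_derive _ _ _ X]mulr1.
  apply: (@is_derive1_comp _ Gam (shift h)); last exact: is_derive_shift.
  by apply: dGam => /=; lra.
have -> : \int[mu]_(t in `[0, T]) ((G (t + h) - G t) / h) = F T - F 0.
  apply: Rintegral_derive => [//||x /andP[x0 _]]; last exact: dF.
  exact/continuous_subspaceT/continuous_difference_quotient.
have mean t : 0 <= t -> `|F t - G t| <= L * h.
  move=> t0; have tth : t < t + h by rewrite ltrDl.
  have [|c /andP[tc cth] e] := @is_derive_mean Gam G t (t + h) tth.
    by move=> x /andP[tx _]; apply: dGam; exact: le_trans t0 tx.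
  rewrite /F e addrAC subrr add0r /GRing.scale /= mulrC mulfK ?gt_eqF//.
  apply: le_trans (GL _ _) _; rewrite ler_wpM2l// ger0_norm; lra.
have := mean T T0; have := mean 0 (lexx _); rewrite !ler_norml => /andP[h1 h2] /andP[h3 h4].
lra.
Qed.

(* The difference quotients of [G] are bounded by its Lipschitz constant, so
   dominated convergence applies to the positive part of their excess over [g]. *)
Lemma lip_le_Rintegral_dini G g (T L C : R) : 0 < T ->
  (forall s t, `|G t - G s| <= L * `|t - s|) ->
  measurable_fun `]0, T[ g -> (forall t, 0 < t < T -> `|g t| <= C) ->
  {ae mu, forall t, 0 < t < T -> forall e, 0 < e ->
     exists2 d, 0 < d & forall h, 0 < h < d -> (G (t + h) - G t) / h <= g t + e} ->
  G T - G 0 <= \int[mu]_(t in `]0, T[) g t.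
Proof.
move=> T0 GL mg gC dini; have cG := lip_continuous GL.
have L0 : 0 <= L := lip_ge0 GL.
have mI : measurable (`]0, T[ : set (measurableTypeR R)) by exact: measurable_itv.
have muI : (mu `]0%R, T[ < +oo)%E.
  by rewrite lebesgue_measure_itv /=; case: ifP => _; rewrite ltry.
have bd_int (f : R -> R) (B : R) : measurable_fun `]0, T[ f ->
    (forall t, 0 < t < T -> `|f t| <= B) -> mu.-integrable `]0, T[ (EFin \o f).
  move=> mf fB; apply: (@measurable_bounded_integrable _ _ _ mu) => //.
  exists B; split; [exact: num_real|move=> y By x /= xT]; apply: le_trans (ltW By).
  by apply: fB; move: xT; rewrite in_itv.
pose h n : R := n.+1%:R^-1; have h0 n : 0 < h n by rewrite invr_gt0.
pose D n t := (G (t + h n) - G t) / h n.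
have DL n t : `|D n t| <= L.
  have hV : 0 < (h n)^-1 by rewrite invr_gt0.
  rewrite normrM (gtr0_norm hV) ler_pdivrMr//.
  by apply: le_trans (GL _ _) _; rewrite addrAC subrr add0r gtr0_norm.
have mD n : measurable_fun `]0, T[ (D n).
  apply: measurable_funM => //; apply: measurable_funB.
    apply: (measurableT_comp (continuous_measurable_fun cG)).
    by apply: measurable_funD.
  exact: measurable_funS (continuous_measurable_fun cG).
pose f n t := Num.max 0 (D n t - g t).
have mf n : measurable_fun `]0, T[ (f n).
  by apply: measurable_maxr => //; exact: measurable_funB.
have fB n t : 0 < t < T -> `|f n t| <= L + C.
  move=> tT; have := gC t tT; have := DL n t.
  rewrite !ler_norml /f => /andP[? ?] /andP[? ?].
  by case: (leP 0 (D n t - g t)) => ?; apply/andP; split; lra.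
have int_f n := bd_int _ _ (mf n) (fB n).
have int_D n := bd_int _ L (mD n) (fun t _ => DL n t).
have int_g := bd_int _ _ mg gC.
have f0 : (fun n => \int[mu]_(t in `]0, T[) f n t) @ \oo --> 0.
  have [|||||_ _] := @dominated_convergence _ _ _ mu `]0, T[ mI
    (fun n => EFin \o f n) (cst 0%E) (cst (L + C)%:E).
  - by move=> n; apply/measurable_EFinP; exact: mf.
  - exact: measurable_cst.
  - apply: negligibleS dini => t /=; apply: contra_not => dt; rewrite in_itv /= => tT.
    apply: cvg_EFin; first by near=> n.
    apply/cvgrPdist_le => /= e e0; have [d d0 Hd] := dt tT e e0.
    near=> n; rewrite sub0r normrN ger0_norm; last by rewrite /f le_max lexx.
    rewrite /f ge_max ltW//= lerBlDl; apply: Hd; rewrite h0 /=.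
    near: n; exact: (near_infty_natSinv_lt (PosNum d0)).
  - by apply: bd_int => [|t _]; [exact: measurable_cst|exact: ler_norm].
  - by apply: aeW => t n /= tT; rewrite lee_fin fB// -in_itv.
  - rewrite integral0_eq//; exact: fine_cvg.
(* The telescoped quotient bounds the left side, and [D n <= g + f n] pointwise; both error terms
   vanish in the limit. *)
have key n : G T - G 0 <= \int[mu]_(t in `]0, T[) g t + (2 * L * h n + \int[mu]_(t in `]0, T[) f n t).
  have := @Rintegral_difference_quotient G T L (h n) (ltW T0) (h0 n) GL.
  have -> : \int[mu]_(t in `[0, T]) ((G (t + h n) - G t) / h n) = \int[mu]_(t in `]0, T[) D n t.
    have iD : mu.-integrable `[0, T] (EFin \o D n).
      apply: continuous_compact_integrable; first exact: segment_compact.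
      exact/continuous_subspaceT/continuous_difference_quotient.
    rewrite -Rintegral_itv_obnd_cbnd; last first.
      by apply: integrableS iD => //; apply: subset_itvr; rewrite bnd_simp.
    rewrite -Rintegral_itv_bndo_bndc//.
    apply: integrableS iD => // x.
    by rewrite /= !in_itv /= => /andP[/ltW -> /ltW ->].
  have : \int[mu]_(t in `]0, T[) D n t <= \int[mu]_(t in `]0, T[) (g t + f n t).
    apply: le_Rintegral => //.
      by have := integrableD mI int_g (int_f n).
    by move=> t _; rewrite -lerBlDl /f le_max lexx orbT.
  rewrite RintegralD//; lra.
apply: (@cvgr_to_ge _ \oo _ _ (fun n => \int[mu]_(t in `]0, T[) g t +
    (2 * L * h n + \int[mu]_(t in `]0, T[) f n t))); last by apply: nearW => n; exact: key.
rewrite -[X in _ --> X]addr0; apply: cvgD; first exact: cvg_cst.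
rewrite -[X in _ --> X]addr0; apply: cvgD; last exact: f0.
by rewrite -[X in _ --> X](mulr0 (2 * L)); apply: cvgM; [exact: cvg_cst|exact: cvg_harmonic].
Unshelve. all: by end_near. Qed.

End lipschitz_calculus.

(** * Compactly supported functions and their primitives *)

Section compact_support.
Context {R : realType}.
Local Notation mu := (@lebesgue_measure R).
Implicit Types (psi f : R -> R) (r K : R).

(** The radius and the bound are explicit so that one pair serves all time slices of a test
    function. *)
Definition compactly_supported r K psi :=
  [/\ 0 <= r, 0 <= K, measurable_fun setT psi, forall x, `|psi x| <= K
    & forall x, r <= `|x| -> psi x = 0].

Lemma compactly_supported_dom r K psi : compactly_supported r K psi ->
  mu.-integrable setT (EFin \o psi) /\ \int[mu]_x `|psi x| <= K * (2 * r).
Proof.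
move=> [r0 K0 mpsi psiK psi0].
have mr : measurable (`[- r, r] : set (measurableTypeR R)) by exact: measurable_itv.
have ic : mu.-integrable setT (EFin \o ((cst K : R -> R) \_ `[- r, r])).
  have : mu.-integrable `[- r, r] (EFin \o (cst K : R -> R)).
    apply: (@measurable_bounded_integrable _ _ _ mu) => //.
      by rewrite /= lebesgue_measure_itv /=; case: ifP => _; rewrite ltry.
    by exists `|K|; split; [exact: num_real|move=> y cy x /= _; exact: ltW].
  by rewrite integrable_mkcond//; apply: eq_integrable => // x _; rewrite /= !patchE; case: ifP.
have le x : `|psi x| <= ((cst K : R -> R) \_ `[- r, r]) x.
  rewrite patchE mem_setE in_itv /= -ler_norml; have [_|/ltW/psi0 ->] := leP `|x| r.
    exact: psiK.
  by rewrite normr0.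
have ipsi : mu.-integrable setT (EFin \o psi).
  apply: le_integrable ic => //; first exact/measurable_EFinP.
  by move=> x _; rewrite /= lee_fin (le_trans (le x))// ler_norm.
split => //; apply: (@le_trans _ _ (\int[mu]_x ((cst K : R -> R) \_ `[- r, r]) x)).
  by apply: le_Rintegral => //; exact: integrable_norm.
rewrite -Rintegral_mkcond Rintegral_cst// fine_mu_itv_cc ?ler_wpM2l//; lra.
Qed.

Lemma compactly_supported_integrable r K psi : compactly_supported r K psi ->
  mu.-integrable setT (EFin \o psi).
Proof. by move=> /compactly_supported_dom[]. Qed.

Lemma compactly_supported_lowint r K psi y : compactly_supported r K psi ->
  `|lowint psi y| <= K * (2 * r).
Proof.
move=> cs; have [ipsi psi_le] := compactly_supported_dom cs.
apply: le_trans psi_le; have il := integrable_natr_lt y ipsi.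
rewrite lowintE//; apply: le_trans (le_normr_Rintegral _ il) _ => //.
apply: le_Rintegral => //; [exact: integrable_norm il|exact: integrable_norm ipsi|].
move=> x _; rewrite normrM ler_piMr//.
by case: (x < y); rewrite ?normr1 ?normr0.
Qed.

(** It lets the estimates on [lowint] also handle the term carrying [abs_coeff]. *)
Lemma compactly_supported_total r K psi : compactly_supported r K psi ->
  \int[mu]_x psi x = lowint psi r.
Proof.
move=> [r0 K0 mpsi psiK psi0].
rewrite /lowint [RHS]Rintegral_mkcond; apply: eq_Rintegral => x _.
rewrite patchE mem_setE in_itv /=; have [//|/ltW rx] := leP x r.
by rewrite psi0// (le_trans rx)// ler_norm.
Qed.

Lemma lowint_sub psi f y : mu.-integrable setT (EFin \o psi) ->
  mu.-integrable setT (EFin \o f) ->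
  lowint (fun x => psi x - f x) y = lowint psi y - lowint f y.
Proof. by move=> ipsi if_; rewrite /lowint RintegralB//; exact: integrable_setT. Qed.

Lemma lowint_scale (a : R) psi y : mu.-integrable setT (EFin \o psi) ->
  lowint (fun x => a * psi x) y = a * lowint psi y.
Proof. by move=> ipsi; rewrite /lowint RintegralZl//; exact: integrable_setT. Qed.

(** Both sides vanish at [- r] and have derivative [psi]. With [psi] the space derivative of a test
    function, the primitive is the test function itself. *)
Lemma lowint_derive r K psi f y : compactly_supported r K psi -> continuous psi ->
  (forall x, r <= `|x| -> f x = 0) -> (forall x : R, is_derive x 1 f (psi x)) ->
  lowint psi y = f y.
Proof.
move=> cs cpsi f0 df; have ipsi := compactly_supported_integrable cs.
have [r0 _ _ _ psi0] := cs.
have low0 z : z <= - r -> lowint psi z = 0.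
  move=> zr; rewrite /lowint (@eq_Rintegral _ _ _ _ _ (cst 0)).
    by rewrite Rintegral_cst ?mul0r//; exact: measurable_itv.
  move=> x; rewrite inE /= in_itv /= => xz; apply: psi0.
  by rewrite ler0_norm; lra.
have [yr|/ltW ry] := leP y (- r).
  by rewrite low0// f0// ler0_norm; lra.
rewrite -[LHS](subrK (lowint psi (- r))) lowintB// low0// addr0.
rewrite Rintegral_itv_obnd_cbnd; last exact: integrable_setT.
have -> : \int[mu]_(x in `[- r, y]) psi x = f y - f (- r).
  by apply: Rintegral_derive => //; exact: continuous_subspaceT.
by rewrite (f0 (- r)) ?subr0// normrN ger0_norm.
Qed.

Lemma is_derive_lowint psi (x : R) : mu.-integrable setT (EFin \o psi) -> continuous psi ->
  is_derive x 1 (lowint psi) (psi x).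
Proof.
move=> ipsi cpsi; have [] := @continuous_FTC1 R psi -oo%O x (x + 1).
- by rewrite ltrDl.
- exact: integrable_setT.
- exact: ltNyr.
- exact: cpsi.
by move=> d1 d2; apply: DeriveDef; [exact: d1|rewrite -derive1E; exact: d2].
Qed.

(** The mean value theorem replaces the increment by [psi c * (b - a)] with [c] between [a] and [b];
    this costs a constant [K] instead of [K / 2]. *)
Lemma lowint_second_order psi (K : R) (a b : R) : mu.-integrable setT (EFin \o psi) ->
  (forall x y, `|psi y - psi x| <= K * `|y - x|) ->
  `|lowint psi b - lowint psi a - psi a * (b - a)| <= K * (b - a) ^+ 2.
Proof.
move=> ipsi psiK; have cpsi := lip_continuous psiK.
have K0 : 0 <= K := lip_ge0 psiK.
have dl x := is_derive_lowint x ipsi cpsi.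
have bound c : `|c - a| <= `|b - a| -> `|psi c * (b - a) - psi a * (b - a)| <= K * (b - a) ^+ 2.
  move=> ca; rewrite -mulrBl normrM -(real_normK (num_real (b - a))) expr2 mulrA.
  by rewrite ler_wpM2r// (le_trans (psiK _ _))// ler_wpM2l.
have [ab|ba|->] := ltgtP a b; last by rewrite !subrr mulr0 subr0 normr0 expr0n mulr0.
- have [c /andP[ac cb] ->] := @is_derive_mean _ (lowint psi) psi a b ab (fun x _ => dl x).
  by apply: bound; rewrite !ger0_norm; lra.
- have [c /andP[ac cb] e] := @is_derive_mean _ (lowint psi) psi b a ba (fun x _ => dl x).
  have -> : lowint psi b - lowint psi a = psi c * (b - a) by rewrite -opprB e; ring.
  by apply: bound; rewrite !ler0_norm; lra.
Qed.

End compact_support.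

(** * Uniform bounds for test functions *)

Section test_functions.
Context {R : realType}.
Implicit Types (phi f : R -> R -> R) (T : R).

Lemma derivable_is_derive1 (f : R -> R) (x : R) : derivable f x 1 -> is_derive x 1 f (derive1 f x).
Proof. by move=> df; apply: DeriveDef => //; rewrite derive1E. Qed.

Lemma near0_derive1 (f : R -> R) (x : R) : (\forall y \near x, f y = 0) -> derive1 f x = 0.
Proof.
by move=> f0; rewrite derive1E (@near_eq_derive _ _ _ f (cst 0))// derive_cst.
Qed.

Lemma continuous_bounded_rect (f : R * R -> R) (S r : R) : continuous f ->
  exists2 K, 0 <= K & forall t x, 0 <= t <= S -> `|x| <= r -> `|f (t, x)| <= K.
Proof.
move=> cf; have cK : compact (f @` (`[0, S] `*` `[- r, r])).
  apply: continuous_compact; first exact: continuous_subspaceT.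
  by apply: compact_setX; exact: segment_compact.
have [M [_ HM]] := compact_bounded cK.
exists `|M + 1| => // t x tS xr; apply: le_trans (ler_norm _).
apply: (HM (M + 1)); first by rewrite ltrDl.
by exists (t, x) => //=; rewrite !in_itv /= -ler_norml.
Qed.

Lemma smooth2_continuous phi w (t : R) : smooth2 phi -> continuous (pderiv w phi t).
Proof.
move=> sm x; apply: (@continuous_comp _ _ _ (fun y => (t, y)) (fun p => pderiv w phi p.1 p.2)).
  by apply: (@cvg_pair _ _ _ (nbhs x) (nbhs t) (nbhs x) _ _ _ (cst t) id);
    [exact: cvg_cst|exact: cvg_id].
exact: ((sm w).2 (t, x)).
Qed.

(* The constant [K] bounds all the derivatives of the test function that are
   needed; for [t > 0] these derivatives vanish where the function does. *)
Lemma test_fun_bounds T S phi : nonneg_test_fun T phi ->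
  let phi_t := pderiv [:: true] phi in let phi_x := pderiv [:: false] phi in
  exists r K, [/\
    forall t, 0 <= t <= S -> compactly_supported r K (phi t),
    forall t, 0 < t <= S -> compactly_supported r K (phi_t t) /\
                            compactly_supported r K (phi_x t),
    forall t x y, 0 <= t <= S -> `|phi t y - phi t x| <= K * `|y - x|,
    forall s t x, 0 <= s <= S -> 0 <= t <= S ->
      `|phi t x - phi s x| <= K * `|t - s| &
    (forall s t x, 0 < s <= S -> 0 < t <= S ->
      `|phi_t t x - phi_t s x| <= K * `|t - s|) /\
    forall t h x, 0 < t -> 0 < h -> t + h <= S ->
      `|phi (t + h) x - phi t x - h * phi_t t x| <= K * h ^+ 2].
Proof.
move=> [sm [_ [T' [R0 [_ phi0]]]]] phi_t phi_x.
(* The added 1 gives [R0 < |x|] strictly when [r <= |x|], so the function vanishes on a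
   neighbourhood of [x] and so does its space derivative. *)
pose r := `|R0| + 1; have r0 : 0 <= r by rewrite addr_ge0.
have rR x : r <= `|x| -> R0 < `|x|.
  by move=> rx; have := ler_norm R0; rewrite /r in rx; lra.
have phi_supp t x : 0 <= t -> r <= `|x| -> phi t x = 0.
  by move=> t0 /rR/ltW rx; apply: phi0 => //; right.
have near_pos (t : R) : 0 < t -> \forall s \near t, 0 < s.
  by move=> t0; apply: (@cvgr_gt _ _ (nbhs t) _ (fun s : R => s) t) => //; exact: cvg_id.
have t_supp t x : 0 < t -> r <= `|x| -> phi_t t x = 0.
  move=> t0 rx; apply: near0_derive1; near=> s; apply: phi_supp => //.
  by apply: ltW; near: s; exact: near_pos.
have x_supp t x : 0 <= t -> r <= `|x| -> phi_x t x = 0.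
  move=> t0 rx; apply: near0_derive1; near=> y; apply: phi0 => //; right.
  apply: ltW; near: y; apply: (@cvgr_gt _ _ (nbhs x) _ (fun y : R => `|y|) `|x|); last exact: rR.
  exact: norm_continuous.
have [K0 K00 HK0] := continuous_bounded_rect S r (sm [::]).2.
have [K1 K10 HK1] := continuous_bounded_rect S r (sm [:: true]).2.
have [K2 K20 HK2] := continuous_bounded_rect S r (sm [:: false]).2.
have [K3 K30 HK3] := continuous_bounded_rect S r (sm [:: true; true]).2.
pose K := K0 + K1 + K2 + K3.
have KK : [/\ 0 <= K, K0 <= K, K1 <= K, K2 <= K & K3 <= K] by split; rewrite /K; lra.
have [Kge0 leK0 leK1 leK2 leK3] := KK.
have bd (f : R -> R) (Ki : R) : 0 <= Ki -> Ki <= K -> (forall x, `|x| <= r -> `|f x| <= Ki) ->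
    (forall x, r <= `|x| -> f x = 0) -> forall x : R, `|f x| <= K.
  move=> Ki0 KiK fr f0 x; have [xr|/ltW rx] := leP `|x| r.
    exact: le_trans (fr x xr) KiK.
  by rewrite f0// normr0.
have cslice w t : continuous (pderiv w phi t) by exact: smooth2_continuous.
exists r, K; split.
- move=> t tS; split => //; first exact: (continuous_measurable_fun (cslice [::] t)).
    apply: (bd _ K0) => // x xr; first exact: HK0.
    by apply: phi_supp => //; case/andP: tS.
  by move=> x; apply: phi_supp; case/andP: tS.
- move=> t /andP[t0 tS]; have tS' : 0 <= t <= S by rewrite ltW.
  split; split => //.
  + exact: (continuous_measurable_fun (cslice [:: true] t)).
  + by apply: (bd _ K1) => // x xr; [exact: HK1|exact: t_supp].
  + by move=> x; exact: t_supp.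
  + exact: (continuous_measurable_fun (cslice [:: false] t)).
  + by apply: (bd _ K2) => // x xr; [exact: HK2|apply: x_supp => //; exact: ltW].
  + by move=> x; apply: x_supp; exact: ltW.
- move=> t x y tS; wlog xy : x y / x < y => [H|].
    have [/H//|/H|->] := ltgtP x y; last by rewrite !subrr normr0 mulr0.
    by rewrite distrC (distrC y).
  have [z _|c _ ->] := @is_derive_mean _ (phi t) (phi_x t) x y xy.
    by apply: derivable_is_derive1; exact: ((sm [::]).1 t z).2.
  rewrite normrM ler_wpM2r//; apply: (bd _ K2) => // z zr; first exact: HK2.
  by apply: x_supp => //; case/andP: tS.
- move=> s t x sS tS; have [rx|xr] := leP r `|x|.
    have [s0 _] := andP sS; have [t0 _] := andP tS.
    by rewrite !phi_supp// subrr normr0 mulr_ge0.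
  wlog st : s t sS tS / s < t => [H|].
    have [/H|/H|->] := ltgtP s t; [exact|by rewrite distrC (distrC t); exact|].
    by rewrite !subrr normr0 mulr0.
  have [s0 _] := andP sS; have [_ tS'] := andP tS.
  have [z _|c /andP[sc ct] ->] := @is_derive_mean _ (phi^~ x) (phi_t^~ x) s t st.
    by apply: derivable_is_derive1; exact: ((sm [::]).1 z x).1.
  rewrite normrM ler_wpM2r// (le_trans _ leK1)//; apply: HK1; last exact: ltW.
  by apply/andP; split; lra.
have Kt s t x : 0 < s <= S -> 0 < t <= S -> `|phi_t t x - phi_t s x| <= K * `|t - s|.
  move=> sS tS; have [rx|xr] := leP r `|x|.
    have [s0 _] := andP sS; have [t0 _] := andP tS.
    by rewrite !t_supp// subrr normr0 mulr_ge0.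
  wlog st : s t sS tS / s < t => [H|].
    have [/H|/H|->] := ltgtP s t; [exact|by rewrite distrC (distrC t); exact|].
    by rewrite !subrr normr0 mulr0.
  have [s0 _] := andP sS; have [_ tS'] := andP tS.
  have [z _|c /andP[sc ct] ->] := @is_derive_mean _ (phi_t^~ x)
      ((pderiv [:: true; true] phi)^~ x) s t st.
    by apply: derivable_is_derive1; exact: ((sm [:: true]).1 z x).1.
  rewrite normrM ler_wpM2r// (le_trans _ leK3)//; apply: HK3; last exact: ltW.
  by apply/andP; split; lra.
split=> // t h x t0 h0 thS; have th : t < t + h by rewrite ltrDl.
have [z _|c /andP[tc cth] ->] := @is_derive_mean _ (phi^~ x) (phi_t^~ x) t (t + h) th.
  by apply: derivable_is_derive1; exact: ((sm [::]).1 z x).1.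
have -> : phi_t c x * (t + h - t) - h * phi_t t x = (phi_t c x - phi_t t x) * h by ring.
rewrite normrM (gtr0_norm h0) expr2 mulrA ler_wpM2r ?(ltW h0)//.
apply: le_trans (Kt t c x _ _) _; [by apply/andP; split; lra..|].
by rewrite ler_wpM2l// ger0_norm; lra.
Unshelve. all: by end_near. Qed.
End test_functions.

(** * The prescribed velocity and the normal cone *)

Section lagrangian.
Context {R : realType}.
Local Notation mu := (@lebesgue_measure R).
Local Notation Omega := (@Omega R).
Implicit Types (F : (R -> R) -> R -> R) (X U : R -> R -> R) (W : R -> R).

Lemma unif_cont_modulus F : unif_cont_on_K F -> exists w : R -> R,
  [/\ {within `[0, +oo[, continuous w}, w 0 = 0 &
    forall Y Z, inK Y -> inK Z ->
      norm2 (fun m => F Y m - F Z m) <= w (norm2 (fun m => Y m - Z m))].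
Proof. by move=> [_ [w [[cw [_ [w0 _]]] Fw]]]; exists w; split. Qed.

(** Continuity of the modulus at 0 combined with the Lipschitz bound on the curve. It makes the
    scalar time integrals in [is_U] additive over subintervals. *)
Lemma inner_F_continuous F X (S : R) (phi : R -> R) : unif_cont_on_K F -> lip_loc_K X ->
  0 < S -> L2 phi -> {within `[0, S], continuous (fun s => inner (F (X s)) phi)}.
Proof.
move=> uF lX S0 Lphi; have [w [cw w0 Fw]] := unif_cont_modulus uF.
have [L L0 HL] := lip_loc_bound lX S0.
have L1 : 0 < L + 1 by rewrite ltr_wpDl.
have N1 : 0 < norm2 phi + 1 by rewrite ltr_wpDl// norm2_ge0.
have KX s : s \in `[0, S] -> inK (X s) by rewrite in_itv /= => /andP[s0 _]; exact: lX.1.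
apply/subspace_continuousP => s sS; apply/cvgrPdist_le => /= e e0.
have /subspace_continuousP/(_ 0) := cw.
rewrite /= in_itv /= lexx => /(_ isT)/cvgrPdist_le /(_ (e / (norm2 phi + 1))).
rewrite divr_gt0// => /(_ isT) /nbhs_ballP[d /= d0 Hd].
apply/nbhs_ballP; exists (d / (L + 1)) => /=; first by rewrite divr_gt0.
move=> t st tS.
have LF u : u \in `[0, S] -> L2 (F (X u)) by move=> uS; apply: uF.1; exact: KX.
rewrite -(innerBl (LF _ sS) (LF _ tS) Lphi); apply: le_trans (cauchy_schwarz (L2B (LF _ sS) (LF _ tS)) Lphi) _.
have dX : norm2 (fun m => X s m - X t m) < d.
  move: sS tS; rewrite !in_itv /= => sS tS.
  apply: le_lt_trans (HL _ _ tS sS) _.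
  apply: (@le_lt_trans _ _ ((L + 1) * `|s - t|)); first by rewrite ler_wpM2r// lerDl.
  by rewrite mulrC -ltr_pdivlMr.
have wX : w (norm2 (fun m => X s m - X t m)) <= e / (norm2 phi + 1).
  have := Hd (norm2 (fun m => X s m - X t m)).
  rewrite /ball /= sub0r normrN ger0_norm ?norm2_ge0// in_itv /= norm2_ge0.
  move=> /(_ dX isT) h.
  have : `|w 0 - w (norm2 (fun m => X s m - X t m))| <= e / (norm2 phi + 1) by exact: h.
  by rewrite w0 sub0r normrN; exact: le_trans (ler_norm _).
apply: (@le_trans _ _ (e / (norm2 phi + 1) * (norm2 phi + 1))); last by rewrite divfK ?gt_eqF.
apply: ler_pM; rewrite ?norm2_ge0 ?lerDl//.
by apply: le_trans (Fw _ _ (KX _ sS) (KX _ tS)) wX.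
Qed.

(** On [[0, S]] the curve stays within [L * S] of [X 0], and the modulus has a maximum on the
    compact interval [[0, L * S]]. *)
Lemma norm2_F_bounded F X (S : R) : unif_cont_on_K F -> lip_loc_K X -> 0 < S ->
  exists2 B, 0 <= B & forall s, 0 <= s <= S -> norm2 (F (X s)) <= B.
Proof.
move=> uF lX S0; have [w [cw w0 Fw]] := unif_cont_modulus uF.
have [L L0 HL] := lip_loc_bound lX S0.
have LS0 : 0 <= L * S by rewrite mulr_ge0// ltW.
have cw' : {within `[0, L * S], continuous w}.
  apply: continuous_subspaceW cw => x /=.
  by rewrite !in_itv /= andbT => /andP[].
have [c _ wc] := EVT_max LS0 cw'.
have KX s : 0 <= s <= S -> inK (X s) by move=> /andP[s0 _]; exact: lX.1.
have K0 : 0 <= (0 : R) <= S by rewrite lexx ltW.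
have LF s : 0 <= s <= S -> L2 (F (X s)) by move=> sS; apply: uF.1; exact: KX.
exists (`|w c| + norm2 (F (X 0))); first by rewrite addr_ge0// norm2_ge0.
move=> s sS; rewrite (@eq_norm2 _ _ (fun m => (F (X s) m - F (X 0) m) + F (X 0) m)); last first.
  by move=> m _; rewrite subrK.
apply: le_trans (norm2D (L2B (LF _ sS) (LF _ K0)) (LF _ K0)) _.
rewrite lerD2r; apply: le_trans (Fw _ _ (KX _ sS) (KX _ K0)) _.
apply: le_trans (ler_norm _); apply: wc; rewrite in_itv /= norm2_ge0 /=.
apply: le_trans (HL _ _ K0 sS) _; rewrite subr0 ler_wpM2l//.
by have /andP[s0 sS'] := sS; rewrite ger0_norm.
Qed.

(** [U] is known only through its pairings, so the increment [d] is tested against itself: the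
    squared norm of [d] is the integral of [inner (F (X r)) d] over []s, t]], at most [B * (t - s)]
    times the norm of [d]. *)
Lemma is_U_lipschitz F X V0 U (S : R) : unif_cont_on_K F -> lip_loc_K X ->
  is_U F X V0 U -> 0 < S -> exists2 B, 0 <= B &
    forall s t, 0 <= s <= S -> 0 <= t <= S -> norm2 (fun m => U t m - U s m) <= B * `|t - s|.
Proof.
move=> uF lX HU S0; have [B B0 HB] := norm2_F_bounded uF lX S0.
exists B => // s t sS tS; wlog st : s t sS tS / s <= t => [H|].
  have [/H|/ltW/H] := leP s t; [exact|rewrite distrC => /(_ tS sS)].
  by rewrite (@eq_norm2 _ _ (fun m => U t m - U s m))// => m _; ring.
have [s0 sS'] := andP sS; have [t0 tS'] := andP tS.
have [LUs Us] := HU s s0; have [LUt Ut] := HU t t0.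
pose d m := U t m - U s m; have Ld : L2 d by exact: L2B.
have [->|dn0] := eqVneq (norm2 d) 0; first by rewrite mulr_ge0.
have dp : 0 < norm2 d by rewrite lt_neqAle eq_sym dn0 norm2_ge0.
rewrite -(ler_pM2r dp) -expr2 norm2_sqr /d innerBl// -/d Us// Ut//.
have it : mu.-integrable `[0, t] (EFin \o (fun r => inner (F (X r)) d)).
  apply: continuous_compact_integrable; first exact: segment_compact.
  apply: continuous_subspaceW (inner_F_continuous uF lX S0 Ld) => x /=.
  by rewrite !in_itv /= => /andP[-> xt]; exact: le_trans xt tS'.
have addBr (p q r : R) : p + q - (p + r) = q - r by ring.
rewrite addBr Rintegral_itvB ?bnd_simp//.
have ist : mu.-integrable `]s, t] (EFin \o (fun r => inner (F (X r)) d)).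
  apply: integrableS it => // x; rewrite /= !in_itv /= => /andP[sx ->].
  by rewrite andbT (le_trans s0)// ltW.
apply: le_trans (ler_norm _) _.
rewrite (ger0_norm (x := t - s)) ?subr_ge0// mulrAC.
apply: norm_Rintegral_itv_le => // x /andP[sx xt].
have xS : 0 <= x <= S by rewrite (le_trans s0 (ltW sx)) (le_trans xt tS').
have LFx : L2 (F (X x)) by apply: uF.1; apply: lX.1; case/andP: xS.
apply: le_trans (cauchy_schwarz LFx Ld) _.
by rewrite ler_wpM2r ?norm2_ge0// HB.
Qed.

Lemma sgr_sub_nonincreasing (k m1 m2 : R) : m1 <= m2 -> Num.sg (k - m2) <= Num.sg (k - m1).
Proof.
rewrite !sgr_subE => m12.
by case: (ltgtP m1 k); case: (ltgtP m2 k) => //= *; lra.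
Qed.

(* Test the variational inequality with [X - eps * sgn(k - .) * phi(X)], which
   is nondecreasing for small [eps] since it jumps upwards at [k]. *)
Lemma normal_cone_test (X : R -> R) W (phi : R -> R) (k K : R) : normal_cone X W ->
  (forall x, 0 <= phi x) -> (forall x y, `|phi y - phi x| <= K * `|y - x|) ->
  0 <= inner W (fun m => Num.sg (k - m) * phi (X m)).
Proof.
move=> [KX [LW HW]] phi0 phiK.
have K0 : 0 <= K := lip_ge0 phiK.
have K1 : 0 < K + 1 by rewrite ltr_wpDl.
pose p m := Num.sg (k - m) * phi (X m).
have Lp : L2 p by apply: L2_sgM; exact: L2_lip phiK KX.1.
pose Y m := X m - (K + 1)^-1 * p m.
have KY : inK Y.
  split; first exact: L2B KX.1 (L2Z _ Lp).
  move=> m1 m2 O1 O2 m12; have y12 := KX.2 m1 m2 O1 O2 m12.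
  have sg12 := sgr_sub_nonincreasing k m12.
  rewrite /Y -subr_ge0.
  have -> : X m2 - (K + 1)^-1 * p m2 - (X m1 - (K + 1)^-1 * p m1) =
    (K + 1)^-1 * ((K + 1) * (X m2 - X m1) - (p m2 - p m1)).
    by field; rewrite gt_eqF.
  rewrite mulr_ge0 ?invr_ge0 ?(ltW K1)// subr_ge0.
  (* The first term is at most [K * (X m2 - X m1)], which the factor [K + 1] absorbs; the second is
     nonpositive because the sign decreases and [phi >= 0]. *)
  have -> : p m2 - p m1 = Num.sg (k - m2) * (phi (X m2) - phi (X m1)) +
      (Num.sg (k - m2) - Num.sg (k - m1)) * phi (X m1) by rewrite /p; ring.
  rewrite -[leRHS]addr0; apply: lerD; last first.
    by rewrite mulr_le0_ge0// subr_le0.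
  apply: le_trans (ler_norm _) _; rewrite normrM.
  apply: (@le_trans _ _ `|phi (X m2) - phi (X m1)|).
    by rewrite ler_piMl//; exact: norm_sgr_le1.
  apply: le_trans (phiK _ _) _; rewrite ger0_norm ?subr_ge0//.
  by rewrite ler_wpM2r ?subr_ge0// lerDl.
have := HW Y KY; rewrite (@eq_inner _ _ (fun m => - (K + 1)^-1 * p m) _ W); last first.
  by move=> m _; rewrite /Y /=; ring.
by rewrite innerZl// innerC mulNr oppr_le0 pmulr_rge0 ?invr_gt0.
Qed.

End lagrangian.

(** * The entropy integral as a functional of the Lagrangian map *)

Section entropy_mass.
Context {R : realType}.
Local Notation mu := (@lebesgue_measure R).
Local Notation Omega := (@Omega R).
Implicit Types (Y Z f g psi : R -> R) (k r K : R).

(** For [psi] supported in [[- r, r]] this is the integral of [|gen_inv Y x - k| * psi x], in a form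
    linear in [lowint psi] that makes its Lipschitz dependence on [Y] visible. *)
Definition entropy_mass k r Y psi :=
  inner (fun=> 1) (fun m => Num.sg (k - m) * lowint psi (Y m)) +
  abs_coeff k * lowint psi r.

Lemma entropy_massE k r K Y psi : inK Y -> compactly_supported r K psi ->
  mu.-integrable setT (EFin \o (fun x => `|gen_inv Y x - k| * psi x)) /\
  \int[mu]_x (`|gen_inv Y x - k| * psi x) = entropy_mass k r Y psi.
Proof.
move=> KY cs; have ipsi := compactly_supported_integrable cs.
have [_ _ _ psiK _] := cs.
have [i1 ->] := abs_gen_inv_integral k KY ipsi psiK.
by split => //; rewrite (compactly_supported_total cs).
Qed.

Lemma compactly_supportedB r (K1 K2 D : R) f g : compactly_supported r K1 f ->
  compactly_supported r K2 g -> (forall x, `|f x - g x| <= D) ->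
  compactly_supported r D (fun x => f x - g x).
Proof.
move=> [r0 _ mf _ f0] [_ _ mg _ g0] fgD; split => //.
- exact: le_trans (normr_ge0 _) (fgD 0).
- exact: measurable_funB.
- by move=> x rx; rewrite f0// g0// subrr.
Qed.

Lemma compactly_supportedZ r K (h : R) f : compactly_supported r K f ->
  compactly_supported r (`|h| * K) (fun x => h * f x).
Proof.
move=> [r0 K0 mf fK f0]; split => //.
- by rewrite mulr_ge0.
- exact: measurable_funM.
- by move=> x; rewrite normrM ler_wpM2l.
- by move=> x rx; rewrite f0// mulr0.
Qed.

Lemma compactly_supported_lip r K psi : compactly_supported r K psi ->
  forall x y, `|lowint psi y - lowint psi x| <= K * `|y - x|.
Proof.
move=> cs x y; have [_ _ _ psiK _] := cs.
exact: lowint_lip (compactly_supported_integrable cs) psiK.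
Qed.

Lemma L2_lowint r K psi Y : compactly_supported r K psi -> L2 Y ->
  L2 (fun m => lowint psi (Y m)).
Proof. by move=> cs; apply: L2_lip; exact: compactly_supported_lip cs. Qed.

Lemma norm2_le_cst f (D : R) : L2 f -> (forall m, `|f m| <= D) -> norm2 f <= D.
Proof.
move=> Lf fD; have D0 : 0 <= D := le_trans (normr_ge0 _) (fD 0).
rewrite -[leRHS](ger0_norm D0) -(norm2_cst D); apply: le_norm2 => //; first exact: L2_cst.
by move=> m _; rewrite (ger0_norm D0).
Qed.

(** [Y] is moved to [Z] at fixed [f], whose primitive is [K1]-Lipschitz; then [f] is replaced by
    [g], which changes the primitive by at most [D * (2 * r)]. *)
Lemma entropy_mass_lip k r (K1 K2 D : R) Y Z f g : L2 Y -> L2 Z ->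
  compactly_supported r K1 f -> compactly_supported r K2 g ->
  (forall x, `|f x - g x| <= D) ->
  `|entropy_mass k r Y f - entropy_mass k r Z g| <=
    K1 * norm2 (fun m => Y m - Z m) + (1 + `|abs_coeff k|) * (D * (2 * r)).
Proof.
move=> LY LZ csf csg fgD.
have csfg := compactly_supportedB csf csg fgD.
have LfY := L2_lowint csf LY; have LfZ := L2_lowint csf LZ; have LgZ := L2_lowint csg LZ.
have low_sub y : lowint f y - lowint g y = lowint (fun x => f x - g x) y.
  by rewrite lowint_sub; [|exact: compactly_supported_integrable csf|
    exact: compactly_supported_integrable csg].
rewrite /entropy_mass.
have addBB (p q s t u : R) : p + u * s - (q + u * t) = (p - q) + u * (s - t) by ring.
rewrite (addBB _ _ (lowint f r) (lowint g r) (abs_coeff k)).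
rewrite (inner_sgMB k (L2_cst 1) LfY LgZ) (low_sub r).
have -> : K1 * norm2 (fun m => Y m - Z m) + (1 + `|abs_coeff k|) * (D * (2 * r)) =
  (K1 * norm2 (fun m => Y m - Z m) + D * (2 * r)) + `|abs_coeff k| * (D * (2 * r)) by ring.
apply: le_trans (ler_normD _ _) _; apply: lerD; last first.
  by rewrite normrM ler_wpM2l//; exact: compactly_supported_lowint csfg.
apply: le_trans (inner_sgM_le k (L2_cst 1) (L2B LfY LgZ)) _.
rewrite norm2_cst normr1 mul1r; apply: le_trans (norm2B LfY LfZ LgZ) _; apply: lerD.
  exact: norm2_lip (compactly_supported_lip csf) LY LZ.
apply: norm2_le_cst; first exact: L2B LfZ LgZ.
by move=> m; rewrite low_sub; exact: compactly_supported_lowint csfg.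
Qed.

Lemma inner_sgMZ u f k (h : R) : L2 u -> L2 f ->
  inner u (fun m => Num.sg (k - m) * (h * f m)) = h * inner u (fun m => Num.sg (k - m) * f m).
Proof.
move=> Lu Lf; rewrite innerC -innerZl ?(innerC u)//; last exact: L2_sgM.
by rewrite innerC; apply: eq_inner => m _; ring.
Qed.

(** A joint first-order expansion in time and position: [Y], [f] are the data at time [t], [Z], [g]
    those at [t + h], and [ft] is the time derivative of the test function. *)
Lemma entropy_mass_expand k r K (h : R) Y Z f g ft : L2 Y -> L2 Z -> 0 <= h ->
  compactly_supported r K f -> compactly_supported r K g -> compactly_supported r K ft ->
  (forall x y, `|f y - f x| <= K * `|y - x|) ->
  (forall x, `|g x - f x - h * ft x| <= K * h ^+ 2) ->
  `|entropy_mass k r Z g - entropy_mass k r Y f - h * entropy_mass k r Y ft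
    - inner (fun m => Z m - Y m) (fun m => Num.sg (k - m) * f (Y m))| <=
  (1 + `|abs_coeff k|) * (K * h ^+ 2 * (2 * r))
  + h * K * norm2 (fun m => Z m - Y m) + K * norm2 (fun m => Z m - Y m) ^+ 2.
Proof.
move=> LY LZ h0 csf csg cst fK exph.
pose d m := Z m - Y m; have Ld : L2 d by exact: L2B.
have [r0 K0 mf fbd _] := csf.
have if_ := compactly_supported_integrable csf.
have ig := compactly_supported_integrable csg.
have it := compactly_supported_integrable cst.
have hcst := compactly_supportedZ h cst.
have ith := compactly_supported_integrable hcst.
have gfbd x : `|g x - f x| <= K + K.
  apply: le_trans (ler_normB _ _) _; apply: lerD; last exact: fbd.
  by have [] := csg.
have csgf := compactly_supportedB csg csf gfbd.
have csE := compactly_supportedB csgf hcst exph.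
have igf := compactly_supported_integrable csgf.
have lowE y : lowint (fun x => g x - f x - h * ft x) y =
    lowint g y - lowint f y - h * lowint ft y.
  by rewrite (lowint_sub y igf ith) (lowint_sub y ig if_) (lowint_scale h y it).
have LgZ := L2_lowint csg LZ; have LfY := L2_lowint csf LY; have LtY := L2_lowint cst LY.
have LfYd : L2 (fun m => f (Y m) * d m).
  have Lfd := @L2M_bounded _ d (fun m => f (Y m)) K Ld.
  rewrite (_ : (fun m => _) = (fun m => d m * f (Y m))); last by apply/funext => m; rewrite mulrC.
  by apply: Lfd => [|m _]; [exact: (measurableT_comp mf LY.1)|exact: fbd].
pose E m := lowint g (Z m) - lowint f (Y m) - h * lowint ft (Y m) - f (Y m) * d m.
have LE : L2 E by exact: L2B (L2B (L2B LgZ LfY) (L2Z h LtY)) LfYd.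
have -> : inner (fun m => Z m - Y m) (fun m => Num.sg (k - m) * f (Y m)) =
    inner (fun=> 1) (fun m => Num.sg (k - m) * (f (Y m) * d m)).
  by apply: eq_inner => m _; rewrite /d; ring.
rewrite /entropy_mass.
have reord (p q s t u v w z : R) :
    p + u * v - (q + u * w) - h * (s + u * z) - t =
    ((p - q) - h * s - t) + u * (v - w - h * z) by ring.
rewrite (reord _ _ _ _ (abs_coeff k) (lowint g r) (lowint f r) (lowint ft r)) -(lowE r).
rewrite (inner_sgMB k (L2_cst 1) LgZ LfY).
rewrite -(inner_sgMZ k h (L2_cst 1) LtY).
rewrite (inner_sgMB k (L2_cst 1) (L2B LgZ LfY) (L2Z h LtY)).
rewrite (inner_sgMB k (L2_cst 1) (L2B (L2B LgZ LfY) (L2Z h LtY)) LfYd) -/E.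
have -> : (1 + `|abs_coeff k|) * (K * h ^+ 2 * (2 * r)) + h * K * norm2 d + K * norm2 d ^+ 2 =
  (K * h ^+ 2 * (2 * r) + h * K * norm2 d + K * norm2 d ^+ 2)
   + `|abs_coeff k| * (K * h ^+ 2 * (2 * r)) by ring.
apply: le_trans (ler_normD _ _) _; apply: lerD; last first.
  by rewrite normrM ler_wpM2l//; exact: compactly_supported_lowint csE.
rewrite innerE; apply: le_trans (le_normr_Rintegral _ (L2_mul (L2_cst 1) (L2_sgM k LE))) _.
  exact: measurable_Omega.
have Ebd m : `|E m| <= K * h ^+ 2 * (2 * r) + h * K * `|d m| + K * (d m * d m).
  (* Three errors: the expansion in time at [Z m], the transport of [ft] from [Z m] back to [Y m],
     and the second-order error of the primitive of [f] in space. *)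
  have -> : E m = lowint (fun x => g x - f x - h * ft x) (Z m)
    + h * (lowint ft (Z m) - lowint ft (Y m))
    + (lowint f (Z m) - lowint f (Y m) - f (Y m) * (Z m - Y m)) by rewrite lowE /E /d; ring.
  apply: le_trans (ler_normD _ _) _; apply: lerD; last first.
    by rewrite -expr2; exact: lowint_second_order.
  apply: le_trans (ler_normD _ _) _; apply: lerD; first exact: compactly_supported_lowint csE.
  by rewrite normrM (ger0_norm h0) -mulrA ler_wpM2l//; exact: compactly_supported_lip cst _ _.
have Labs := L2_norm Ld.
have i1 : mu.-integrable Omega (EFin \o (fun m => K * h ^+ 2 * (2 * r) + h * K * `|d m|)).
  exact: L2_integrable (L2D (L2_cst _) (L2Z _ Labs)).
have i2 : mu.-integrable Omega (EFin \o (fun m => K * (d m * d m))).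
  by have := integrableZl (@measurable_Omega R) K (L2_mul Ld Ld).
apply: (@le_trans _ _ (\int[mu]_(m in Omega)
    (K * h ^+ 2 * (2 * r) + h * K * `|d m| + K * (d m * d m)))).
  apply: le_Rintegral; first exact: measurable_Omega.
  - exact: integrable_norm (L2_mul (L2_cst 1) (L2_sgM k LE)).
  - by have := integrableD (@measurable_Omega R) i1 i2.
  move=> m _; apply: le_trans (Ebd m); rewrite mul1r normrM ler_piMl//.
  exact: norm_sgr_le1.
rewrite (RintegralD (@measurable_Omega R) i1 i2).
rewrite (RintegralD (@measurable_Omega R) (L2_integrable (L2_cst _)) (L2_integrable (L2Z _ Labs))).
rewrite (RintegralZl _ (@measurable_Omega R) (L2_mul Ld Ld)) -(innerE d d) -norm2_sqr.
rewrite (RintegralZl _ (@measurable_Omega R) (L2_integrable Labs)).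
rewrite Rintegral_cst; last exact: measurable_Omega.
rewrite [X in fine X]mu_Omega /= mulr1 lerD2r lerD2l ler_wpM2l ?mulr_ge0//.
exact: Rintegral_norm_le.
Qed.

End entropy_mass.

(** * The entropy flux and one time step *)

Section entropy_inequality.
Context {R : realType}.
Local Notation mu := (@lebesgue_measure R).
Local Notation Omega := (@Omega R).

Lemma entropy_flux_integral (k r K : R) (Y u psi_t psi_x f : R -> R) : inK Y -> L2 u ->
  compactly_supported r K psi_t -> compactly_supported r K psi_x -> continuous psi_x ->
  (forall x, r <= `|x| -> f x = 0) -> (forall x : R, is_derive x 1 f (psi_x x)) ->
  (\int[mu]_(x in setT) (`|gen_inv Y x - k| * psi_t x +
     Num.sg (gen_inv Y x - k) * (cumul u (gen_inv Y x) - cumul u k) * psi_x x)%:E =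
  (entropy_mass k r Y psi_t + inner u (fun m => Num.sg (k - m) * f (Y m)))%:E)%E.
Proof.
move=> KY Lu cst csx cpsi f0 df.
have lowf y : lowint psi_x y = f y by exact: (lowint_derive y csx cpsi f0 df).
have ix := compactly_supported_integrable csx; have [r0 _ _ xK _] := csx.
have [i1 e1] := entropy_massE k KY cst.
have [i2 e2] := kernel_integral k KY Lu ix xK.
(* The total integral of [psi_x] is [f r = 0], which removes the constant term of
   [kernel_integral]. *)
rewrite (compactly_supported_total csx) (lowf r) f0 ?ger0_norm// mulr0 addr0 in e2.
pose E x := `|gen_inv Y x - k| * psi_t x +
  psi_x x * (Num.sg (gen_inv Y x - k) * (cumul u (gen_inv Y x) - cumul u k)).
have iE : mu.-integrable setT (EFin \o E) by have := integrableD measurableT i1 i2.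
transitivity (\int[mu]_x (E x)%:E)%E.
  by apply: eq_integral => x _; congr EFin; rewrite /E; congr (_ + _); rewrite mulrC.
rewrite -(fineK (integrable_fin_num measurableT iE)); congr EFin.
transitivity (\int[mu]_x E x); first by [].
rewrite /E (RintegralD measurableT i1 i2) {}e1 {}e2; congr (_ + _).
by apply: eq_inner => m _; rewrite lowf.
Qed.

(** In the first-order expansion the quotient [(Z - Y) / h] is replaced by [W] through
    Cauchy-Schwarz, then [W] by [u] through the sign given by [normal_cone_test]. The bound [L * h]
    on the displacement makes the remaining error linear in [h] after division. *)
Lemma entropy_mass_step (k r K L h : R) (Y Z f g ft u W : R -> R) : inK Y -> inK Z -> 0 < h ->
  compactly_supported r K f -> compactly_supported r K g -> compactly_supported r K ft ->
  (forall x, 0 <= f x) -> (forall x y, `|f y - f x| <= K * `|y - x|) ->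
  (forall x, `|g x - f x - h * ft x| <= K * h ^+ 2) ->
  L2 u -> L2 W -> normal_cone Y (fun m => u m - W m) ->
  norm2 (fun m => Z m - Y m) <= L * h ->
  (entropy_mass k r Z g - entropy_mass k r Y f) / h <=
  entropy_mass k r Y ft + inner u (fun m => Num.sg (k - m) * f (Y m))
  + (K * norm2 (fun m => (Z m - Y m) / h - W m)
     + ((1 + `|abs_coeff k|) * (K * (2 * r)) + K * L + K * L ^+ 2) * h).
Proof.
move=> KY KZ h0 csf csg cst f0 fK exph Lu LW HN dL.
have [r0 K0 mf fbd _] := csf.
have := entropy_mass_expand k KY.1 KZ.1 (ltW h0) csf csg cst fK exph.
have Lp : L2 (fun m => Num.sg (k - m) * f (Y m)) by apply: L2_sgM; exact: L2_lip fK KY.1.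
have pK : norm2 (fun m => Num.sg (k - m) * f (Y m)) <= K.
  apply: norm2_le_cst => // m; rewrite normrM (le_trans _ (fbd (Y m)))// ler_piMl//.
  exact: norm_sgr_le1.
have Lq : L2 (fun m => (Z m - Y m) / h).
  rewrite (_ : (fun m => _) = (fun m => h^-1 * (Z m - Y m))).
    exact: L2Z (L2B KZ.1 KY.1).
  by apply/funext => m; rewrite mulrC.
have := normal_cone_test k HN f0 fK; rewrite (innerBl Lu LW Lp).
have -> : inner (fun m => Z m - Y m) (fun m => Num.sg (k - m) * f (Y m)) =
    h * inner (fun m => (Z m - Y m) / h) (fun m => Num.sg (k - m) * f (Y m)).
  rewrite -(innerZl h Lq Lp); apply: eq_inner => m _; congr (_ * _).
  by rewrite mulrCA mulfV ?mulr1// gt_eqF.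
have := cauchy_schwarz (L2B Lq LW) Lp; rewrite (innerBl Lq LW Lp).
move: (inner _ _) (inner W _) (inner u _) => a b c.
set N := norm2 (fun m => (Z m - Y m) / h - W m).
move: (norm2 _) pK => p pK CS.
have {CS}CS : `|a - b| <= K * N.
  by apply: le_trans CS _; rewrite mulrC ler_wpM2r// norm2_ge0.
move: dL; have := @norm2_ge0 R (fun m => Z m - Y m).
move: (norm2 _) => d d0 dL bc.
move: (entropy_mass k r Z g) (entropy_mass k r Y f) (entropy_mass k r Y ft) => e1 e2 e3.
move=> /(le_trans (ler_norm _)) est.
rewrite ler_pdivrMr//.
have d2 : d ^+ 2 <= (L * h) ^+ 2 by rewrite lerXn2r// nnegrE (le_trans d0).
have Kd2 : K * d ^+ 2 <= K * (L * h) ^+ 2 by rewrite ler_wpM2l.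
have hKd : h * K * d <= h * K * (L * h) by rewrite ler_wpM2l// mulr_ge0// ltW.
(* [a], [b], [c] pair the quotient, [W] and [u] with the test function; [b <= c] by normality, so
   [a - c <= a - b]. *)
have ac : h * (a - c) <= h * (K * N).
  by rewrite ler_wpM2l ?(ltW h0)//; have := ler_norm (a - b); lra.
move: est Kd2 hKd ac; rewrite !exprMn; set B := 1 + `|_|; set n := N; nra.
Qed.

End entropy_inequality.

(** * The integrated entropy inequality *)

Section entropy_solutions.
Context {R : realType}.
Local Notation mu := (@lebesgue_measure R).
Local Notation Omega := (@Omega R).

Lemma lowint_cst0 (r : R) (psi : R -> R) y : 0 <= r -> (forall x, psi x = 0) -> lowint psi y = 0.
Proof.
move=> r0 psi0; have cs : compactly_supported r 0 psi.
  split => // [|x]; last by rewrite psi0 normr0.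
  by rewrite (_ : psi = cst 0)//; apply/funext => x; exact: psi0.
by have := compactly_supported_lowint y cs; rewrite mul0r normr_le0 => /eqP.
Qed.

(** The projection onto [[0, S]]; composing with it turns a Lipschitz bound on [[0, S]] into one on
    the whole line, as [lip_le_Rintegral_dini] requires. *)
Definition clamp (S t : R) := Num.max 0 (Num.min t S).

Lemma clamp_itv (S t : R) : 0 <= S -> 0 <= clamp S t <= S.
Proof.
move=> S0; rewrite /clamp le_max lexx /= ge_max S0 /=.
by rewrite ge_min lexx orbT.
Qed.

Lemma clamp_id (S t : R) : 0 <= t <= S -> clamp S t = t.
Proof. by move=> /andP[t0 tS]; rewrite /clamp min_l// max_r. Qed.

Lemma clamp_lip (S s t : R) : `|clamp S t - clamp S s| <= `|t - s|.
Proof.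
wlog st : s t / s <= t => [H|].
  by have [/H//|/ltW/H] := leP s t; rewrite distrC (distrC s).
rewrite (ger0_norm (x := t - s)) ?subr_ge0// ler_norml /clamp.
case: (leP t S) => ?; case: (leP s S) => ?; case: (leP 0 t) => ?;
  case: (leP 0 s) => ?; case: (leP 0 S) => ?; apply/andP; split; lra.
Qed.

Lemma L2_deriv_eps (X : R -> R -> R) (t : R) (W : R -> R) (e : R) : L2_deriv X t W -> 0 < e ->
  exists2 d, 0 < d & forall h, 0 < h < d ->
    norm2 (fun m => (X (t + h) m - X t m) / h - W m) <= e.
Proof.
move=> [_ /cvgrPdist_le /= dX] e0; have /nbhs_ballP[d /= d0 Hd] := dX e e0.
exists d => // h /andP[h0 hd].
have := Hd h; rewrite /ball /= !sub0r normrN gtr0_norm// => /(_ hd).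
rewrite gt_eqF// => /(_ isT); rewrite normrN ger0_norm ?norm2_ge0//.
Qed.

Lemma entropy_inequality (F : (R -> R) -> R -> R) (X0 V0 : R -> R) (T : R)
    (X U : R -> R -> R) (k : R) (phi : R -> R -> R) :
  unif_cont_on_K F -> inK X0 -> 0 < T -> lagrangian_solution F X0 V0 X U ->
  nonneg_test_fun T phi ->
  (0 <= \int[mu]_(t in (`]0%R, T%R[ : set R)) \int[mu]_(x in [set: R])
     (`|gen_inv (X t) x - k| * (pderiv [:: true] phi) t x +
      Num.sg (gen_inv (X t) x - k) *
        (cumul (U t) (gen_inv (X t) x) - cumul (U t) k) * (pderiv [:: false] phi) t x)%:E
   + \int[mu]_(x in [set: R]) (`|gen_inv X0 x - k| * phi 0 x)%:E)%E.
Proof.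
move=> uF KX0 T0 [lX [eX0 [HU Hae]]] Hphi.
(* All bounds are taken up to [2 * T], so that [t + h] stays in range for [t < T] and [h < T]. *)
pose S := T + T; have S0 : 0 < S by rewrite /S; lra.
have [r [K [bphi bder xlip tlip [ttlip texp]]]] := test_fun_bounds S Hphi.
set phi_t := pderiv [:: true] phi in bder ttlip texp *.
set phi_x := pderiv [:: false] phi in bder *.
have [sm [phi_ge0 [T' [R0 [T'T phi0]]]]] := Hphi.
have [L L0 HL] := lip_loc_bound lX S0.
have [B B0 HB] := is_U_lipschitz uF lX HU S0.
have zS : 0 <= (0 : R) <= S by rewrite lexx ltW.
have [r0 K0 _ _ _] := bphi 0 zS.
have KX t : 0 <= t <= S -> inK (X t) by move=> /andP[t0 _]; exact: lX.1.
have ooS t : 0 < t < T -> 0 < t <= S by rewrite /S => /andP[t0 tT]; rewrite t0; lra.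
have ocW t : 0 < t <= S -> 0 <= t <= S by move=> /andP[/ltW -> ->].
have LU t : 0 <= t <= S -> L2 (U t) by move=> /andP[t0 _]; have [] := HU t t0.
pose G t := entropy_mass k r (X t) (phi t).
pose b t := inner (U t) (fun m => Num.sg (k - m) * phi t (X t m)).
pose g t := entropy_mass k r (X t) (phi_t t) + b t.
pose C1 := K * L + (1 + `|abs_coeff k|) * (K * (2 * r)).
have c0 : 0 <= 1 + `|abs_coeff k| by rewrite addr_ge0.
have C10 : 0 <= C1 by rewrite addr_ge0// mulr_ge0// mulr_ge0// mulr_ge0.
have HG s t : 0 <= s <= S -> 0 <= t <= S -> `|G t - G s| <= C1 * `|t - s|.
  move=> sS tS; apply: le_trans (entropy_mass_lip k (KX t tS).1 (KX s sS).1
    (bphi t tS) (bphi s sS) (fun x => tlip s t x sS tS)) _.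
  have := ler_wpM2l K0 (HL s t sS tS); rewrite /C1; nra.
have Lphi t : 0 <= t <= S -> L2 (fun m => phi t (X t m)).
  by move=> tS; apply: L2_lip (KX t tS).1 => x y; exact: xlip.
have Hmass s t : 0 < s <= S -> 0 < t <= S ->
    `|entropy_mass k r (X t) (phi_t t) - entropy_mass k r (X s) (phi_t s)| <= C1 * `|t - s|.
  move=> sS tS; apply: le_trans (entropy_mass_lip k (KX t (ocW t tS)).1 (KX s (ocW s sS)).1
    (bder t tS).1 (bder s sS).1 (fun x => ttlip s t x sS tS)) _.
  have := ler_wpM2l K0 (HL s t (ocW s sS) (ocW t tS)); rewrite /C1; nra.
pose Ub := norm2 (U 0) + B * S.
have HUb t : 0 <= t <= S -> norm2 (U t) <= Ub.
  move=> tS; rewrite (@eq_norm2 _ _ (fun m => (U t m - U 0 m) + U 0 m)); last first.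
    by move=> m _; rewrite subrK.
  apply: le_trans (norm2D (L2B (LU t tS) (LU 0 zS)) (LU 0 zS)) _.
  rewrite addrC lerD2l; apply: le_trans (HB 0 t zS tS) _.
  by rewrite subr0 ler_wpM2l//; have /andP[t0 tS'] := tS; rewrite ger0_norm.
have Ub0 : 0 <= Ub by rewrite addr_ge0 ?norm2_ge0// mulr_ge0// ltW.
have Hb s t : 0 <= s <= S -> 0 <= t <= S ->
    `|b t - b s| <= (B * K + Ub * (K * L + K)) * `|t - s|.
  move=> sS tS.
  have Lts : L2 (fun m => phi t (X s m)) by apply: L2_lip (KX s sS).1 => x y; exact: xlip.
  (* A product rule; the second increment is split again at [phi t (X s m)], to vary position and
     time separately. *)
  have -> : b t - b s = inner (fun m => U t m - U s m) (fun m => Num.sg (k - m) * phi t (X t m))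
      + inner (U s) (fun m => Num.sg (k - m) * (phi t (X t m) - phi s (X s m))).
    rewrite (innerBl (LU t tS) (LU s sS) (L2_sgM k (Lphi t tS))).
    by rewrite -(inner_sgMB k (LU s sS) (Lphi t tS) (Lphi s sS)) addrA subrK.
  apply: le_trans (ler_normD _ _) _; rewrite mulrDl; apply: lerD.
    apply: le_trans (inner_sgM_le k (L2B (LU t tS) (LU s sS)) (Lphi t tS)) _.
    rewrite mulrAC; apply: ler_pM; rewrite ?norm2_ge0//; first exact: HB.
    by apply: norm2_le_cst; [exact: Lphi|move=> m; have [_ _ _ ->] := bphi t tS].
  apply: le_trans (inner_sgM_le k (LU s sS) (L2B (Lphi t tS) (Lphi s sS))) _.
  rewrite -mulrA; apply: ler_pM; rewrite ?norm2_ge0//; first exact: HUb.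
  apply: le_trans (norm2B (Lphi t tS) Lts (Lphi s sS)) _; rewrite mulrDl; apply: lerD.
    apply: le_trans (norm2_lip (fun x y => xlip t x y tS) (KX t tS).1 (KX s sS).1) _.
    by rewrite -mulrA ler_wpM2l// HL.
  by apply: norm2_le_cst; [exact: L2B Lts (Lphi s sS)|move=> m; exact: tlip].
pose Cg := C1 + (B * K + Ub * (K * L + K)).
have Cg0 : 0 <= Cg.
  by rewrite addr_ge0// addr_ge0// mulr_ge0// addr_ge0// mulr_ge0.
have Hg s t : 0 < s < T -> 0 < t < T -> `|g t - g s| <= Cg * `|t - s|.
  move=> /ooS sS /ooS tS; rewrite /g opprD addrACA /Cg mulrDl.
  apply: le_trans (ler_normD _ _) _; apply: lerD; first exact: Hmass.
  by apply: Hb; exact: ocW.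
have mg : measurable_fun `]0, T[ g.
  apply: subspace_continuous_measurable_fun; first exact: measurable_itv.
  by apply: (lip_on_continuous Cg0) => s t; rewrite /= !in_itv /=; exact: Hg.
have gb t : 0 < t < T -> `|g t| <= `|g (T / 2)| + Cg * T.
  (* An interior reference time, because [phi_t] is controlled only for positive times. *)
  move=> tT; have hT : 0 < T / 2 < T by apply/andP; split; lra.
  rewrite -[g t](subrK (g (T / 2))) addrC (le_trans (ler_normD _ _))// lerD2l.
  apply: le_trans (Hg _ _ hT tT) _; rewrite ler_wpM2l//.
  by have /andP[? ?] := tT; rewrite ler_norml; apply/andP; split; lra.
have mI : measurable (`]0, T[ : set (measurableTypeR R)) by exact: measurable_itv.
have ig : mu.-integrable `]0, T[ (EFin \o g).
  apply: (@measurable_bounded_integrable _ _ _ mu) => //.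
    by rewrite /= lebesgue_measure_itv /=; case: ifP => _; rewrite ltry.
  exists (`|g (T / 2)| + Cg * T); split; [exact: num_real|move=> y By x /= xT].
  by apply: le_trans (ltW By); apply: gb; move: xT; rewrite in_itv.
pose Gc t := G (clamp S t).
have HGc s t : `|Gc t - Gc s| <= C1 * `|t - s|.
  apply: le_trans (HG _ _ (clamp_itv s (ltW S0)) (clamp_itv t (ltW S0))) _.
  by rewrite ler_wpM2l// clamp_lip.
pose C2 := (1 + `|abs_coeff k|) * (K * (2 * r)) + K * L + K * L ^+ 2.
have C20 : 0 <= C2.
  by rewrite !addr_ge0// ?mulr_ge0// ?mulr_ge0// exprn_ge0.
have dini : {ae mu, forall t, 0 < t < T -> forall e, 0 < e ->
     exists2 d, 0 < d & forall h, 0 < h < d -> (Gc (t + h) - Gc t) / h <= g t + e}.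
  apply: negligibleS Hae => t /=; apply: contra_not => Ht tT e e0.
  have /andP[t0 tT'] := tT; have tS := ocW _ (ooS t tT).
  have [W [dW HN]] := Ht (ltW t0).
  have K1 : 0 < K + 1 by rewrite ltr_wpDl.
  have C21 : 0 < C2 + 1 by rewrite ltr_wpDl.
  (* [e1] bounds the error in the velocity, which enters with factor [K]; [e2] bounds [h], which
     enters with factor [C2]. *)
  pose e1 := e / 2 / (K + 1); pose e2 := e / 2 / (C2 + 1).
  have e10 : 0 < e1 by rewrite !divr_gt0.
  have e20 : 0 < e2 by rewrite !divr_gt0.
  have Ke1 : (K + 1) * e1 = e / 2 by rewrite mulrC divfK// gt_eqF.
  have Ce2 : (C2 + 1) * e2 = e / 2 by rewrite mulrC divfK// gt_eqF.
  have [d1 d10 Hd1] := L2_deriv_eps dW e10.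
  exists (Num.min d1 (Num.min T e2)) => [|h]; first by rewrite !lt_min d10 T0.
  rewrite !lt_min => /and4P[h0 hd1 hT he2].
  have thS : 0 <= t + h <= S by rewrite /S; apply/andP; split; lra.
  have dX : norm2 (fun m => X (t + h) m - X t m) <= L * h.
    apply: le_trans (HL t (t + h) tS thS) _.
    by rewrite addrAC subrr add0r gtr0_norm.
  have tpS := ooS t tT.
  have := entropy_mass_step k (KX t tS) (KX _ thS) h0 (bphi t tS) (bphi _ thS)
    (bder t tpS).1 (fun x => phi_ge0 t x (ltW t0)) (fun x y => xlip t x y tS)
    (fun x => texp t h x t0 h0 (andP thS).2) (LU t tS) dW.1 HN dX.
  rewrite /Gc !clamp_id// -/(G _) -/(G _) -/(b t) -/(g t) -/C2 => /le_trans; apply.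
  rewrite lerD2l; have N := Hd1 h; rewrite h0 hd1 in N; have {N}N := N isT.
  have := ler_wpM2l K0 N; have := ler_wpM2l C20 (ltW he2).
  by move: Ke1 Ce2; lra.
have := lip_le_Rintegral_dini T0 HGc mg gb dini.
have -> : Gc T = 0.
  have phiT x : phi T x = 0 by apply: phi0; [exact: ltW|left; exact: ltW].
  have T1 : 0 <= T <= S by rewrite /S; apply/andP; split; lra.
  rewrite /Gc clamp_id// /G /entropy_mass (lowint_cst0 r r0 phiT) mulr0 addr0.
  rewrite (@eq_inner _ _ (fun=> 1) _ (fun m => Num.sg (k - m) * (0 * 1))) => [|m _].
    by rewrite (inner_sgMZ k 0 (L2_cst 1) (L2_cst 1)) mul0r.
  by rewrite (lowint_cst0 (X T m) r0 phiT) mul0r.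
have -> : Gc 0 = G 0 by rewrite /Gc clamp_id.
rewrite sub0r => main.
(* [X 0] and [X0] agree only in the L2 norm, so the Lipschitz estimate is used with distance 0. *)
have G0 : G 0 = entropy_mass k r X0 (phi 0).
  apply/eqP; rewrite -subr_eq0 -normr_le0.
  have phi00 x : `|phi 0 x - phi 0 x| <= 0 by rewrite subrr normr0.
  apply: le_trans (entropy_mass_lip k (KX 0 zS).1 KX0.1 (bphi 0 zS) (bphi 0 zS) phi00) _.
  by rewrite mul0r mulr0 addr0 [norm2 _]eX0 mulr0.
have [i0 e0] := entropy_massE k KX0 (bphi 0 zS).
have -> : (\int[mu]_(x in [set: R]) (`|gen_inv X0 x - k| * phi 0 x)%:E = (G 0)%:E)%E.
  by rewrite -(fineK (integrable_fin_num measurableT i0)) G0 -e0.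
have -> : (\int[mu]_(t in (`]0%R, T%R[ : set R)) \int[mu]_(x in [set: R])
     (`|gen_inv (X t) x - k| * phi_t t x +
      Num.sg (gen_inv (X t) x - k) *
        (cumul (U t) (gen_inv (X t) x) - cumul (U t) k) * phi_x t x)%:E =
   (\int[mu]_(t in `]0%R, T%R[) g t)%:E)%E.
  rewrite /Rintegral fineK; last exact: (integrable_fin_num mI ig).
  apply: eq_integral => t.
  rewrite inE /= in_itv /= => tT; have tS := ooS t tT.
  apply: (@entropy_flux_integral R k r K (X t) (U t) (phi_t t) (phi_x t) (phi t)).
  - exact: KX (ocW t tS).
  - exact: LU (ocW t tS).
  - exact: (bder t tS).1.
  - exact: (bder t tS).2.
  - exact: smooth2_continuous.
  - by have [] := bphi t (ocW t tS).
  - by move=> x; apply: derivable_is_derive1; exact: ((sm [::]).1 t x).2.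
by rewrite -EFinD lee_fin; lra.
Qed.

End entropy_solutions.

Theorem theorem5p5 (R : realType) (F : (R -> R) -> (R -> R))
    (X0 V0 : R -> R) (T : R) (X U : R -> R -> R) :
  unif_cont_on_K F -> inK X0 -> L2 V0 -> 0 < T ->
  lagrangian_solution F X0 V0 X U ->
  entropy_solution T (calU U) (fun t => gen_inv (X t)) (gen_inv X0).
Proof.
move=> uF KX0 LV0 T0 sol; have [lX _] := sol.
have KX t : 0 <= t <= T -> inK (X t) by move=> /andP[t0 _]; exact: lX.1.
split; first exact: measurable_gen_inv_curve.
split.
  exists 1 => t x /KX Kt.
  by rewrite ger0_norm ?gen_inv_ge0//; exact: gen_inv_le1.
split; first by move=> t /KX Kt; exact: measurable_gen_inv.
split; first by move=> a b t0 t0T; exact: gen_inv_L1_continuous.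
(* The inequality holds for every real [k], so the dense set is the whole line. *)
exists setT; split; first by move=> O [x Ox] _; exists x.
by move=> k _ phi test; exact: (entropy_inequality k uF KX0 T0 sol test).
Qed.
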